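(* The competitive ratio of the MLE satisfies $$\lim_{d\to\infty}\mathfrak C^{\mathsf{MLE}}(\mathsf B^d_p,\sigma)=\infty$$ in each of the following situations: (i) $p\in(1,2)$ is fixed, independent of $d$, and $\sigma=\sigma(d)>0$ is any sequence of noise levels with $\sigma^p d\gg 1$ and $\sigma^2\log d\ll 1$; (ii) $p=p(d)$ is a sequence of norm indices with $p(d)-1\gg \tfrac{1}{1+\log d}$ and $\limsup_{d\to\infty}p(d)<2$, and $\sigma=\sigma(d)>0$ is any sequence of noise levels with $\sigma^p d\gg d^{2-p}\big(1-\tfrac1p\big)^{p/2}$ and $\sigma^2\log d\ll1$ (with $p=p(d)$).
   Context: For nonnegative sequences, $f(d)\gg g(d)$ means $f(d)/g(d)\to\infty$ as $d\to\infty$, and $f\ll g$ means $g\gg f$. For $p\ge1$, $\mathsf{B}^d_p=\{x\in\mathbf{R}^d:\|x\|_p\le 1\}$ where $\|x\|_p=(\sum_i|x_i|^p)^{1/p}$. For a closed convex set $\Theta\subset\mathbf{R}^d$, $\Pi_\Theta(y)=\arg\min_{\vartheta\in\Theta}\|\vartheta-y\|_2^2$ is the Euclidean projection (the maximum likelihood estimator, MLE, in the model $Y\sim\mathsf N(\theta^\star,\sigma^2I_d)$, $\theta^\star\in\Theta$). Define $$\mathcal R^{\mathsf{MLE}}(\Theta,\sigma)=\sup_{\theta^\star\in\Theta}\mathbf E_{Y\sim\mathsf N(\theta^\star,\sigma^2I_d)}\|\Pi_\Theta(Y)-\theta^\star\|_2^2,\qquad \mathcal M(\Theta,\sigma)=\inf_{\hat\theta}\sup_{\theta^\star\in\Theta}\mathbf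 E_{Y\sim\mathsf N(\theta^\star,\sigma^2I_d)}\|\hat\theta(Y)-\theta^\star\|_2^2,$$ the infimum being over all measurable $\hat\theta:\mathbf R^d\to\mathbf R^d$, and $\mathfrak C^{\mathsf{MLE}}(\Theta,\sigma)=\mathcal R^{\mathsf{MLE}}(\Theta,\sigma)/\mathcal M(\Theta,\sigma)$. *)

(* Defs.v *)
From HB Require Import structures.
From mathcomp Require Import all_boot all_order all_algebra.
From mathcomp Require Import all_classical all_reals all_analysis.

Set Implicit Arguments.
Unset Strict Implicit.
Unset Printing Implicit Defensive.

Import Order.TTheory GRing.Theory Num.Theory.
Import numFieldNormedType.Exports.

Local Open Scope classical_set_scope.
Local Open Scope ring_scope.

Definition much_greater (R : realType) (f g : R^nat) : Prop :=
  (f d / g d) @[d --> \oo] --> +oo.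

Definition much_less (R : realType) (f g : R^nat) : Prop := much_greater g f.

(* Points of R^d are d-tuples: the library equips [d.-tuple R] with the
   sigma-algebra generated by the coordinates, i.e. the Borel sigma-algebra. *)

Definition sqdist (R : realType) (d : nat) (x y : d.-tuple R) : R :=
  \sum_(i < d) (tnth x i - tnth y i) ^+ 2.

Definition lp_norm (R : realType) (d : nat) (p : R) (x : d.-tuple R) : R :=
  (\sum_(i < d) `|tnth x i| `^ p) `^ p^-1.

Definition lp_ball (R : realType) (d : nat) (p : R) : set (d.-tuple R) :=
  [set x | lp_norm p x <= 1].

Section product_probability.
Context {disp : measure_display} {T : measurableType disp} {R : realType}.

Definition tcons n (x : T * n.-tuple T) : n.+1.-tuple T :=
  [the n.+1.-tuple T of x.1 :: x.2].

Lemma measurable_tcons n : measurable_fun [set: T * n.-tuple T] (@tcons n).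
Proof. exact: measurable_cons. Qed.

HB.instance Definition _ n :=
  isMeasurableFun.Build _ _ _ _ (@tcons n) (@measurable_tcons n).

(* The law of a tuple of independent variables X_i ~ P_i; see [prod_probE]. *)
Fixpoint prod_prob n : ('I_n -> probability T R) -> probability (n.-tuple T) R :=
  match n with
  | 0 => fun=> \d_[tuple]
  | m.+1 => fun P =>
      distribution (P ord0 \x prod_prob (fun i => P (lift ord0 i)))%E (@tcons m)
  end.

Lemma prod_probE n (P : 'I_n -> probability T R) (A : 'I_n -> set T) :
  (forall i, measurable (A i)) ->
  prod_prob P [set x | forall i, A i (tnth x i)] = (\prod_(i < n) P i (A i))%E.
Proof.
elim: n P A => [|n IH] P A mA /=.
  by rewrite big_ord0 diracE mem_set// => -[].
rewrite big_ord_recl -IH// /distribution /pushforward.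
rewrite [X in (_ \x _)%E X](_ : _ =
    A ord0 `*` [set x | forall i, A (lift ord0 i) (tnth x i)]).
  rewrite product_measure1E//.
  rewrite [X in measurable X](_ : _ =
      \bigcap_(i in [set: 'I_n]) ((@tnth _ T ^~ i) @^-1` A (lift ord0 i))).
    apply: fin_bigcap_measurable => // i _; rewrite -[X in measurable X]setTI.
    exact: measurable_tnth.
  by apply/seteqP; split => x /= xA i; [move=> _; exact: xA | exact: xA].
apply/seteqP; split => -[x y] /=.
  move=> xyA; split; first by have := xyA ord0.
  by move=> i; have := xyA (lift ord0 i); rewrite tnthS.
move=> [xA yA] i; case: (unliftP ord0 i) => [j ->|-> //].
by rewrite tnthS.
Qed.

End product_probability.

Section gaussian.
Context {R : realType}.

(* [measurableTypeR R] and [R] carry the same sigma-algebra under different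
   displays; [normal_law m s] is [normal_prob m s], which has mean m and
   standard deviation s, retyped as a probability on [R]. *)
Definition real_id : measurableTypeR R -> R := idfun.

HB.instance Definition _ :=
  isMeasurableFun.Build _ _ _ _ real_id (@measurable_id _ _ setT).

Definition normal_law (m s : R) : probability R R :=
  distribution (normal_prob m s) real_id.

Definition gaussian (d : nat) (theta : d.-tuple R) (sigma : R) :
    probability (d.-tuple R) R :=
  prod_prob (fun i => normal_law (tnth theta i) sigma).

End gaussian.

(* For nonempty closed convex Theta the argmin is a singleton; the default
   value y is only taken when no minimizer exists. *)
Definition projection (R : realType) (d : nat) (Theta : set (d.-tuple R))
    (y : d.-tuple R) : d.-tuple R :=
  xget y [set t | Theta t /\ forall u, Theta u -> sqdist t y <= sqdist u y].

Definition worst_risk (R : realType) (d : nat) (Theta : set (d.-tuple R))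
    (sigma : R) (estimator : d.-tuple R -> d.-tuple R) : \bar R :=
  ereal_sup [set 'E_(gaussian theta sigma)[
                   (fun Y => sqdist (estimator Y) theta)]%E | theta in Theta].

Definition mle_risk (R : realType) (d : nat) (Theta : set (d.-tuple R))
    (sigma : R) : \bar R :=
  worst_risk Theta sigma (projection Theta).

Definition minimax_risk (R : realType) (d : nat) (Theta : set (d.-tuple R))
    (sigma : R) : \bar R :=
  ereal_inf [set worst_risk Theta sigma estimator |
              estimator in [set f | measurable_fun [set: d.-tuple R] f]].

Definition mle_competitive_ratio (R : realType) (d : nat)
    (Theta : set (d.-tuple R)) (sigma : R) : \bar R :=
  (mle_risk Theta sigma / minimax_risk Theta sigma)%E.

(* Main.v *)
Require Import Defs.
From HB Require Import structures.
From mathcomp Require Import all_boot all_order all_algebra.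
From mathcomp Require Import all_classical all_reals all_analysis.
From mathcomp Require Import measurable_realfun.
From mathcomp Require Import ring lra.

Set Implicit Arguments.
Unset Strict Implicit.
Unset Printing Implicit Defensive.

Import Order.TTheory GRing.Theory Num.Theory.
Import numFieldNormedType.Exports.
Local Open Scope classical_set_scope.
Local Open Scope ring_scope.

(** Put q = p / (p - 1) and Y = theta + sigma Z.

    Upper bound on the minimax risk: soft thresholding at level sigma l has risk
    at most 16 (sigma l)^(2 - p) + 32 d sigma^2 exp(- l^2 / 4) over the l_p ball.
    With l^2 = 4 ln d this tends to 0, and for fixed p the choice
    l^2 = 4 ln (sigma^p d) gives a bound that is << sigma d^(1/q).

    Lower bound on the risk of the MLE: let theta have k coordinates equal to a,
    with k a^p = 1, and let x be the projection of Y.  For every u in the ball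
    2 sigma <Z, u - theta> - |u - theta|^2 <= 2 sigma <Z, x - theta>.  Take
    u = (theta + v) / 2 with v supported off theta and <sigma Z, v> comparable to
    the dual norm sigma |Z|_q.  If |x - theta| <= e |theta|, then the part of x
    off theta satisfies |x|_p^p <= 2 e, so <sigma Z, x> is too small to compete
    with u as soon as |theta|^2 is a small multiple of sigma |Z|_q.  Hence the
    risk is at least of order |theta|^2 = k^(1 - 2/p).  In case (i), k can be
    chosen with this quantity of order min(1, sigma d^(1/q)); in case (ii) the
    hypothesis says that sigma sqrt(q) d^(1/q) tends to infinity, k = 1 works,
    and the risk stays bounded away from 0. *)

(** * Gaussian product measures *)

Section product_integral.
Context {disp : measure_display} {T : measurableType disp} {R : realType}.

Lemma measurable_prod_tnth n (f : 'I_n -> T -> R) :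
  (forall i, measurable_fun [set: T] (f i)) ->
  measurable_fun [set: n.-tuple T] (fun x => \prod_(i < n) f i (tnth x i)).
Proof.
move=> mf; apply: measurable_prod => i _.
exact: (measurableT_comp (mf i) (measurable_tnth i)).
Qed.

(** Induction on [n]: Tonelli separates the first coordinate from the remaining tuple, and
    nonnegativity lets the constant factors leave the integrals. *)
Lemma prod_prob_integral n (P : 'I_n -> probability T R) (f : 'I_n -> T -> R) :
  (forall i, measurable_fun [set: T] (f i)) -> (forall i x, 0 <= f i x) ->
  (\int[prod_prob P]_x (\prod_(i < n) f i (tnth x i))%:E =
   \prod_(i < n) \int[P i]_x (f i x)%:E)%E.
Proof.
elim: n P f => [|n IH] P f mf f0 /=.
  rewrite big_ord0.
  under eq_integral do rewrite big_ord0.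
  by rewrite integral_dirac// diracT mul1e.
have mg : measurable_fun [set: n.-tuple T]
    (fun y => \prod_(i < n) f (lift ord0 i) (tnth y i)).
  exact: (@measurable_prod_tnth _ (fun i => f (lift ord0 i))).
rewrite ge0_integral_distribution; last 2 first.
- by apply/measurable_EFinP; exact: measurable_prod_tnth.
- by move=> y; rewrite lee_fin prodr_ge0.
have E (x : T * n.-tuple T) : (\prod_(i < n.+1) f i (tnth (tcons x) i)) =
    f ord0 x.1 * \prod_(i < n) f (lift ord0 i) (tnth x.2 i).
  rewrite big_ord_recl; congr (_ * _).
  by apply: eq_bigr => i _; rewrite tnthS.
under eq_integral do rewrite /= E.
rewrite fubini_tonelli1; last 2 first.
- apply/measurable_EFinP; apply: measurable_funM.
    exact: measurableT_comp.
  exact: (measurableT_comp mg measurable_snd).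
- by move=> x; rewrite lee_fin mulr_ge0 ?prodr_ge0.
rewrite /fubini_F /= big_ord_recl -IH//.
under eq_integral => x _.
  rewrite (_ : integral _ _ _ = (f ord0 x)%:E *
    \int[prod_prob (fun i => P (lift ord0 i))]_y
      (\prod_(i < n) f (lift ord0 i) (tnth y i))%:E)%E; last first.
    under eq_integral do rewrite EFinM.
    rewrite ge0_integralZl//; first exact/measurable_EFinP.
      by move=> y _; rewrite lee_fin prodr_ge0.
    by rewrite lee_fin.
  over.
rewrite /= ge0_integralZr//; first exact/measurable_EFinP.
  by move=> x _; rewrite lee_fin.
by apply: integral_ge0 => y _; rewrite lee_fin prodr_ge0.
Qed.

(** The product formula with every factor except the [j]-th equal to 1. *)
Lemma prod_prob_marginal n (P : 'I_n -> probability T R) (j : 'I_n) (g : T -> R) :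
  measurable_fun [set: T] g -> (forall x, 0 <= g x) ->
  (\int[prod_prob P]_x (g (tnth x j))%:E = \int[P j]_x (g x)%:E)%E.
Proof.
move=> mg g0.
pose f i := if i == j then g else cst 1.
have := @prod_prob_integral n P f.
rewrite (bigD1 j)//= big1 ?mule1; last first.
  move=> i /negbTE ij; rewrite /f ij/=.
  by rewrite integral_cst//= mul1e probability_setT.
rewrite {4}/f eqxx => <-.
- apply: eq_integral => x _; rewrite (bigD1 j)//= big1 ?mulr1 ?/f ?eqxx//.
  by move=> i /negbTE ->.
- by move=> i; rewrite /f; case: ifP.
- by move=> i x; rewrite /f; case: ifP => //= _; exact: ler01.
Qed.

End product_integral.

(** * One-dimensional normal laws: densities, an exponential moment and a tail bound *)

Section normal.
Context {R : realType}.
Implicit Types m s t : R.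

Lemma normal_prob_integral m s (f : measurableTypeR R -> \bar R) :
  measurable_fun [set: measurableTypeR R] f -> (forall x, 0 <= f x)%E ->
  (\int[normal_prob m s]_x f x =
   \int[lebesgue_measure]_x (f x * (normal_pdf m s x)%:E))%E.
Proof.
move=> mf f0.
have dom := normal_prob_dominates m s.
rewrite -(@Radon_Nikodym_SigmaFinite.change_of_variables _ _ _ (normal_prob m s)
  (@lebesgue_measure R) dom f setT)//.
have mRN := Radon_Nikodym_SigmaFinite.f_integrable dom.
apply: ae_eq_integral => //.
- apply: emeasurable_funM => //; exact: (measurable_int (@lebesgue_measure R)).
- by apply: emeasurable_funM => //; apply/measurable_EFinP; exact: measurable_normal_pdf.
- apply: ae_eqe_mul2l; apply: integral_ae_eq => //.
  + by apply/measurable_EFinP; exact: measurable_normal_pdf.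
  + by move=> E _ mE; rewrite -(Radon_Nikodym_SigmaFinite.f_integral dom mE).
Qed.

Lemma normal_law_integral m s (f : R -> R) :
  measurable_fun [set: R] f -> (forall x, 0 <= f x) ->
  (\int[normal_law m s]_x (f x)%:E =
   \int[lebesgue_measure]_x (f x * normal_pdf m s x)%:E)%E.
Proof.
move=> mf f0; rewrite ge0_integral_distribution//; last exact/measurable_EFinP.
rewrite normal_prob_integral//; exact/measurable_EFinP.
Qed.

(** A single weight that dominates every moment used below. The constant 3/8 stays below the 1/2 of
    the normal density, so the weight remains integrable. *)
Definition exp_moment m s (x : R) : R := expR (3 / 8 * ((x - m) / s) ^+ 2).

Lemma measurable_exp_moment m s : measurable_fun [set: R] (exp_moment m s).
Proof.
apply: measurableT_comp => //; apply: measurable_funM => //.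
by apply: measurable_funX; apply: measurable_funM => //; exact: measurable_funB.
Qed.

(* Tilting N(m, s^2) by this weight gives twice the density of N(m, (2 s)^2). *)
Lemma normal_law_exp_moment m s : 0 < s ->
  (\int[normal_law m s]_x (exp_moment m s x)%:E = 2%:E)%E.
Proof.
move=> s0; rewrite normal_law_integral; last 2 first.
- exact: measurable_exp_moment.
- by move=> x; exact: expR_ge0.
have sn0 : s != 0 by rewrite gt_eqF.
have s2 : s *+ 2 != 0 by rewrite mulrn_eq0.
transitivity (\int[lebesgue_measure]_x (2 * normal_pdf m (s *+ 2) x)%:E)%E.
  apply: eq_integral => x _; congr EFin.
  rewrite !normal_pdfE// /normal_fun /exp_moment mulrCA -expRD [RHS]mulrA; congr (_ * expR _).
    rewrite /normal_peak.
    have -> : (s *+ 2) ^+ 2 * pi *+ 2 = 2 ^+ 2 * (s ^+ 2 * pi *+ 2) :> R by ring.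
    rewrite sqrtrM ?exprn_ge0// sqrtr_sqr ger0_norm// invfM mulrA divff ?mul1r//.
  by field.
under eq_integral do rewrite EFinM.
rewrite ge0_integralZl//; last 2 first.
- by apply/measurable_EFinP; exact: measurable_normal_pdf.
- by move=> x _; rewrite lee_fin normal_pdf_ge0.
by rewrite integral_normal_pdf mule1.
Qed.

(** Amounts to [2 * pi <= 9], which follows from [pi / 2 < 2]. *)
Lemma normal_peak_lower_bound s : 0 < s -> 1 <= normal_peak s * (3 * s).
Proof.
move=> s0; rewrite /normal_peak mulrC ler_pdivlMr ?mul1r; last first.
  by rewrite sqrtr_gt0 pmulrn_lgt0// mulr_gt0 ?pi_gt0// exprn_gt0.
have s30 : 0 <= 3 * s by rewrite mulr_ge0// ltW.
rewrite -(ger0_norm s30) -sqrtr_sqr ler_wsqrtr// exprMn mulrC -mulrnAr.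
have := @pihalf_lt2 R; have := exprn_gt0 2 s0; nra.
Qed.

Lemma normal_law_tail m s t : 0 < s -> 0 <= t ->
  ((expR (- (t + 1) ^+ 2 / 2) / 3)%:E <=
   \int[normal_law m s]_x (t * s <= `|x - m|)%R%:R%:E)%E.
Proof.
move=> s0 t0; have sn0 : s != 0 by rewrite gt_eqF.
have mf : measurable_fun [set: R] (fun x : R => (t * s <= `|x - m|)%R%:R : R).
  rewrite (_ : (fun x => _) = \1_[set x : R | t * s <= `|x - m|]); last first.
    by apply/funext => x; rewrite indicE mem_setE.
  apply: measurable_indic.
  rewrite -[X in measurable X]setTI; apply: measurable_fun_le => //.
  by apply: measurableT_comp => //; exact: measurable_funB.
rewrite normal_law_integral//.
set c := expR _ / 3.
have c0 : 0 <= c by rewrite divr_ge0 ?expR_ge0.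
(* On this interval of length [s] the density is at least [expR (- (t + 1) ^+ 2 / 2) / (3 * s)], and
   one side of the tail is enough. *)
pose I := `[m + t * s, m + (t + 1) * s]%classic : set (measurableTypeR R).
have mI : measurable I by exact: measurable_itv.
have -> : (c%:E = \int[lebesgue_measure]_x (c / s * \1_I x)%:E)%E.
  under eq_integral do rewrite EFinM.
  rewrite ge0_integralZl//; last 2 first.
  - by apply/measurable_EFinP; exact: measurable_indic.
  - by rewrite lee_fin divr_ge0// ltW.
  have -> : (\int[lebesgue_measure]_x (\1_I x)%:E = s%:E)%E.
    rewrite integral_indic//.
    rewrite setIT.
    have := @lebesgue_measure_itv R `[m + t * s, m + (t + 1) * s].
    rewrite /= lte_fin.
    rewrite ifT; last by rewrite ltrD2l ltr_pM2r// ltrDl.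
    move=> ->; rewrite -EFinD; congr EFin; ring.
  by rewrite -EFinM divfK.
apply: ge0_le_integral => //.
- by move=> x _; rewrite lee_fin mulr_ge0// divr_ge0// ltW.
- apply/measurable_EFinP; apply: measurable_funM => //; exact: measurable_indic.
- apply/measurable_EFinP; apply: measurable_funM => //; exact: measurable_normal_pdf.
- move=> x _; rewrite lee_fin indicE.
  case: (boolP (x \in I)) => [|_]; last by rewrite mulr0 mulr_ge0// normal_pdf_ge0.
  rewrite inE /I /= in_itv/= => /andP[x1 x2].
  have xm : t * s <= x - m by lra.
  have xm0 : 0 <= x - m by rewrite (le_trans _ xm)// mulr_ge0// ltW.
  rewrite (ger0_norm xm0) xm mulr1 mul1r normal_pdfE// /normal_fun.
  rewrite /c -mulrA mulrC ler_pM//.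
  + by rewrite mulr_ge0 ?invr_ge0// ltW.
  + by rewrite -invfM -[leLHS]mul1r ler_pdivrMr ?mulr_gt0// normal_peak_lower_bound.
  + rewrite ler_expR !mulNr lerN2 ler_pdivrMr ?pmulrn_lgt0 ?exprn_gt0//.
    rewrite (_ : _ * _ = ((t + 1) * s) ^+ 2); last by field.
    rewrite lerXn2r ?nnegrE//; first by rewrite mulr_ge0 ?addr_ge0// ltW.
    lra.
Qed.

End normal.

(** * Projection onto an l_p ball *)

Section lp_ball.
Context {R : realType}.
Implicit Types p : R.

Lemma lp_ballE d p (x : d.-tuple R) : 0 < p ->
  lp_ball p x <-> \sum_(i < d) `|tnth x i| `^ p <= 1.
Proof.
move=> p0; rewrite /lp_ball /= /lp_norm.
set S := \sum_(i < d) _; have S0 : 0 <= S by apply: sumr_ge0 => i _; exact: powR_ge0.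
have ip0 : 0 <= p^-1 by rewrite invr_ge0 ltW.
split=> H.
  have := @ge0_ler_powR _ p (ltW p0) _ _ (powR_ge0 _ _) ler01 H.
  by rewrite powR1 -powRrM mulVf ?gt_eqF// powRr1.
have := @ge0_ler_powR _ p^-1 ip0 _ _ S0 ler01 H.
by rewrite powR1.
Qed.

Lemma continuous_norm_powR p : 1 <= p -> continuous (fun x : R => `|x| `^ p).
Proof.
move=> p1 x; have p0 : 0 < p by rewrite (lt_le_trans _ p1).
(* The power is differentiable only at positive arguments; at 0 the bound [|y| ^ p <= |y|] for
   [|y| <= 1] replaces it. *)
have [->|x0] := eqVneq x 0.
  rewrite /continuous_at normr0 powR0 ?gt_eqF//.
  apply/cvgrPdist_le => e e0; near=> y.
  rewrite sub0r normrN ger0_norm ?powR_ge0//.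
  have ye : `|y| <= Num.min 1 e.
    near: y; apply/nbhs_ballP; exists (Num.min 1 e) => /=.
      by rewrite lt_min ltr01.
    by move=> z; rewrite /ball /= sub0r normrN => /ltW.
  move: ye; rewrite le_min => /andP[y1 ye].
  have [y0|yn0] := eqVneq `|y| 0; first by rewrite y0 powR0 ?gt_eqF// ltW.
  rewrite (le_trans _ ye)// ge1r_powR// y1 andbT lt_neqAle eq_sym yn0 /=.
  exact: normr_ge0.
apply: (@continuous_comp _ _ _ (fun y : R => `|y|) (fun y => y `^ p)).
  exact: norm_continuous.
apply/differentiable_continuous/derivable1_diffP/derivable_powR.
by rewrite in_itv/= andbT normr_gt0.
Unshelve. all: by end_near. Qed.

(** The ball is compact and nonempty and the distance is continuous, so a minimizer exists and
    [xget] does not fall back on its default. *)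
Lemma projection_lp_ball d p (y : d.-tuple R) : 1 <= p ->
  lp_ball p (projection (@lp_ball R d p) y) /\
  forall u, lp_ball p u -> sqdist (projection (@lp_ball R d p) y) y <= sqdist u y.
Proof.
move=> p1; have p0 : 0 < p by rewrite (lt_le_trans _ p1).
(* Compactness is argued on row vectors, which carry the topology, and transported to tuples by
   [tup]. *)
pose tup (v : 'rV[R]_d) := [tuple v ord0 i | i < d].
pose K := [set v : 'rV[R]_d | \sum_(i < d) `|v ord0 i| `^ p <= 1].
have KE v : K v <-> lp_ball p (tup v).
  rewrite lp_ballE// /K /=.
  by under [X in _ <-> is_true (X <= 1)]eq_bigr do rewrite tnth_mktuple.
have cK : closed K.
  pose f (v : 'rV[R]_d) := \sum_(i < d) `|v ord0 i| `^ p.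
  have cf : continuous f.
    apply: (continuous_big (op := +%R)) => [|i _ v]; first exact: add_continuous.
    apply: (@continuous_comp _ _ _ (fun v : 'rV[R]_d => v ord0 i) (fun y => `|y| `^ p)).
      exact: coord_continuous.
    exact: continuous_norm_powR.
  have -> : K = f @^-1` [set x | x <= 1] by [].
  by apply: preimage_closed => //; exact: closed_le.
have bK : bounded_set K.
  exists 1; split; first exact: real1.
  move=> M M1 v Kv.
  rewrite /= [leLHS]/Num.Def.normr /= mx_normrE; apply/bigmax_leP; split => /=.
    by rewrite ltW// (lt_trans _ M1).
  move=> [i j] _ /=; rewrite (ord1 i).
  apply: (le_trans _ (ltW M1)).
  rewrite leNgt; apply/negP => v1.
  have := Kv; rewrite /K /= (bigD1 j)//= => Kv1.
  have : 1 < `|v ord0 j| `^ p by rewrite (lt_le_trans v1)// le1r_powR// ltW.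
  move=> v1p; have : 0 <= \sum_(i < d | i != j) `|v ord0 i| `^ p.
    by apply: sumr_ge0 => k _; exact: powR_ge0.
  lra.
have K0 : K !=set0.
  exists 0; rewrite /K /=.
  by rewrite big1 ?ler01// => i _; rewrite mxE normr0 powR0// gt_eqF.
have cdist : {within K, continuous (fun v => sqdist (tup v) y)}.
  apply: continuous_subspaceT => v.
  rewrite /sqdist; apply: (continuous_big (op := +%R)) => [|i _ {}v].
    exact: add_continuous.
  under eq_fun do rewrite tnth_mktuple.
  have cc : {for v, continuous (fun v : 'rV[R]_d => v ord0 i - tnth y i)}.
    by apply: continuousB; [exact: coord_continuous|exact: cst_continuous].
  under eq_fun do rewrite expr2.
  exact: (continuousM cc cc).
have [c cK' cmin] := EVT_min_rV K0 (bounded_closed_compact bK cK) cdist.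
rewrite /projection; apply: (@xgetPex _ y
  [set t | lp_ball p t /\ forall u, lp_ball p u -> sqdist t y <= sqdist u y]).
exists (tup c); split; first by apply/KE; rewrite inE in cK'.
move=> u u1; have /cmin : (\row_i tnth u i) \in K.
  by rewrite inE; apply/KE; rewrite (_ : tup _ = u)//; apply: eq_from_tnth => i;
    rewrite tnth_mktuple mxE.
by rewrite (_ : tup (\row_i tnth u i) = u)//; apply: eq_from_tnth => i;
    rewrite tnth_mktuple mxE.
Qed.

End lp_ball.

(** * Deterministic geometry: a projection close to the spike contradicts minimality *)

Section deterministic.
Context {R : realType}.
Implicit Types p a e x : R.

(** On the unit interval [x ^ p >= x ^ 2 >= 2 x - 1]. *)
Lemma powR_tangent p x : 1 <= p <= 2 -> 0 <= x <= 1 -> 2 * x - 1 <= x `^ p.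
Proof.
move=> /andP[p1 p2] /andP[x0 x1].
have [->|xn0] := eqVneq x 0.
  by rewrite (le_trans _ (powR_ge0 _ _))//; lra.
have xp : 0 < x by rewrite lt_neqAle eq_sym xn0.
have : x `^ 2%:R <= x `^ p by apply: ger_powR => //; rewrite xp.
rewrite powR_mulrn//; nra.
Qed.

(** After scaling by [a], a linear loss [2 (1 - t)] is traded for [e + (1 - t) ^ 2 / e]. The
    quadratic form lets the loss be summed using only the Euclidean distance. *)
Lemma powR_perturb p a e x : 1 <= p <= 2 -> 0 < a -> 0 < e ->
  a `^ p * (1 - e - (x - a) ^+ 2 / (e * a ^+ 2)) <= `|x| `^ p.
Proof.
move=> /andP[p1 p2] a0 e0; have p0 : 0 < p by rewrite (lt_le_trans _ p1).
pose t := `|x| / a; have t0 : 0 <= t by rewrite divr_ge0// ltW.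
have -> : `|x| `^ p = a `^ p * t `^ p.
  by rewrite -powRM ?(ltW a0)// /t mulrCA divff ?mulr1// gt_eqF.
rewrite ler_wpM2l ?powR_ge0//.
have h0 : 0 <= (x - a) ^+ 2 / (e * a ^+ 2).
  by rewrite divr_ge0 ?sqr_ge0// mulr_ge0 ?sqr_ge0// ltW.
have [t1|t1] := leP 1 t.
  by rewrite (le_trans _ (le1r_powR t1 p1))//; lra.
rewrite (le_trans _ (powR_tangent _ _))//; last 2 first.
- by rewrite p1.
- by rewrite t0 ltW.
have ht : (1 - t) ^+ 2 <= ((x - a) / a) ^+ 2.
  rewrite -[leRHS]real_normK ?num_real// lerXn2r ?nnegrE//; first lra.
  have -> : 1 - t = (a - `|x|) / a by rewrite /t; field; rewrite gt_eqF.
  rewrite normrM (gtr0_norm (_ : 0 < a^-1)) ?invr_gt0//.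
  rewrite ler_wpM2r ?invr_ge0 ?(ltW a0)// distrC.
  by rewrite -{1}(gtr0_norm a0); exact: lerB_dist.
have -> : (x - a) ^+ 2 / (e * a ^+ 2) = ((x - a) / a) ^+ 2 / e.
  by field; rewrite !gt_eqF.
have : (1 - t) ^+ 2 / e <= ((x - a) / a) ^+ 2 / e by rewrite ler_pM2r ?invr_gt0.
have : 2 * (1 - t) - e <= (1 - t) ^+ 2 / e.
  rewrite ler_pdivlMr//; have := sqr_ge0 (1 - t - e); nra.
lra.
Qed.

Lemma sum_ord_lt d k (c : R) : (k <= d)%N -> \sum_(i < d | (i < k)%N) c = k%:R * c.
Proof.
move=> kd; rewrite -(big_ord_widen d (fun=> c))// sumr_const card_ord mulr_natl//.
Qed.

Definition spike d k a : d.-tuple R := [tuple if (i < k)%N then a else 0 | i < d].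

Lemma spike_lp_ball d k p a : 0 < p -> 0 < a -> (k <= d)%N -> k%:R * a `^ p <= 1 ->
  lp_ball p (spike d k a).
Proof.
move=> p0 a0 kd ka; apply/lp_ballE => //.
rewrite (le_trans _ ka)// -(@sum_ord_lt d)// [leRHS]big_mkcond/=.
apply: ler_sum => i _; rewrite tnth_mktuple; case: ifP => _.
  by rewrite gtr0_norm.
by rewrite normr0 powR0 ?gt_eqF.
Qed.

(** The deterministic core of the lower bound. [w] is the noise, [B] bounds its action on the part
    of the ball off the spike, and [v] is a direction off the spike that the noise favours. A
    projection near the spike has too little mass left off it to compete with a move towards [v]. *)
Lemma projection_far d k p a s e B (y v : d.-tuple R) (w := fun i =>
    tnth y i - tnth (spike d k a) i) :
  1 <= p <= 2 -> 0 < a -> 0 < s <= a -> 0 < e <= 1 ->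
  (k <= d)%N -> k%:R * a `^ p = 1 ->
  \sum_(i < d | (i < k)%N) w i ^+ 2 <= 32 * k%:R * s ^+ 2 ->
  (forall i : 'I_d, (i < k)%N -> tnth v i = 0) ->
  \sum_(i < d) `|tnth v i| `^ p <= 1 ->
  (forall x : d.-tuple R, (forall i : 'I_d, (i < k)%N -> tnth x i = 0) ->
    \sum_(i < d) `|tnth x i| `^ p <= 1 -> \sum_(i < d) w i * tnth x i <= B) ->
  2 * (2 * e) `^ p^-1 * B + 51 * (k%:R * a ^+ 2) + \sum_(i < d) tnth v i ^+ 2 <
    \sum_(i < d) w i * tnth v i ->
  e ^+ 2 * (k%:R * a ^+ 2) <
    sqdist (projection (@lp_ball R d p) y) (spike d k a).
Proof.
move=> /[dup] p12 /andP[p1 p2] a0 /andP[s0 sa] /andP[e0 e1] kd ka wS vS v1 HB HG.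
have p0 : 0 < p by rewrite (lt_le_trans _ p1).
have [xB xmin] := projection_lp_ball y p1.
set x := projection _ _ in xB xmin *.
rewrite ltNge; apply/negP => xclose.
pose h i := tnth x i - tnth (spike d k a) i.
pose S := fun i : 'I_d => (i < k)%N.
have spS i : S i -> tnth (spike d k a) i = a by rewrite tnth_mktuple /S => ->.
have spNS i : ~~ S i -> tnth (spike d k a) i = 0.
  by rewrite tnth_mktuple /S => /negbTE ->.
have hS : \sum_(i < d | S i) h i ^+ 2 <= e ^+ 2 * (k%:R * a ^+ 2).
  apply: le_trans xclose; rewrite /sqdist [leRHS](bigID S)/= lerDl.
  by apply: sumr_ge0 => i _; exact: sqr_ge0.
(* The spike spends the whole budget [k a ^ p = 1]. By [powR_perturb] and [hS], [x] still spends at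
   least [1 - e - e] of it on [S]. *)
have offx : \sum_(i < d | ~~ S i) `|tnth x i| `^ p <= 2 * e.
  have := xB => /(lp_ballE _ p0); rewrite (bigID S)/=.
  suff : 1 - 2 * e <= \sum_(i < d | S i) `|tnth x i| `^ p by lra.
  have : \sum_(i < d | S i) (a `^ p * (1 - e) - a `^ p / (e * a ^+ 2) * h i ^+ 2) <=
      \sum_(i < d | S i) `|tnth x i| `^ p.
    apply: ler_sum => i Si.
    apply: le_trans (powR_perturb (tnth x i) p12 a0 e0).
    rewrite /h spS// le_eqVlt; apply/orP; left; apply/eqP.
    by field; rewrite !gt_eqF.
  apply: le_trans.
  rewrite sumrB sum_ord_lt// -mulr_sumr mulrA ka.
  have cpos : 0 < a `^ p / (e * a ^+ 2).
    by rewrite divr_gt0 ?powR_gt0// mulr_gt0// exprn_gt0.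
  have := ler_wpM2l (ltW cpos) hS.
  have -> : a `^ p / (e * a ^+ 2) * (e ^+ 2 * (k%:R * a ^+ 2)) = (k%:R * a `^ p) * e.
    by field; rewrite !gt_eqF.
  rewrite ka; lra.
have e20 : 0 < 2 * e by rewrite mulr_gt0.
set m := (2 * e) `^ p^-1 in HG.
have m0 : 0 < m by rewrite powR_gt0.
have mp : m `^ p = 2 * e by rewrite -powRrM mulVf ?gt_eqF// powRr1// ltW.
(* Dividing the part of [x] off [S] by [m] brings it into the unit ball, where [HB] applies. *)
have wx : \sum_(i < d | ~~ S i) w i * tnth x i <= m * B.
  rewrite mulrC -ler_pdivrMr// mulr_suml.
  have := HB [tuple if S i then 0 else tnth x i / m | i < d].
  rewrite (bigID S)/= big1 ?add0r; last first.
    by move=> i Si; rewrite tnth_mktuple Si normr0 powR0// gt_eqF.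
  rewrite (_ : \sum_(i < d) w i * _ = \sum_(i < d | ~~ S i) w i * tnth x i / m).
    apply.
  - by move=> i Si; rewrite tnth_mktuple /S Si.
  - under eq_bigr => i /negbTE Si.
      rewrite tnth_mktuple Si normrM (gtr0_norm (_ : 0 < m^-1)) ?invr_gt0//.
      rewrite powRM ?invr_ge0 ?(ltW m0)//.
      over.
    rewrite -mulr_suml -powR_inv1 ?(ltW m0)// powRAC mp powR_inv1 ?(ltW e20)//.
    by rewrite ler_pdivrMr// mul1r.
  rewrite (bigID S)/= big1 ?add0r.
    by apply: eq_bigr => i /negbTE Si; rewrite tnth_mktuple Si mulrA.
  by move=> i Si; rewrite tnth_mktuple Si mulr0.
(* The competitor: the spike and [v] have disjoint supports, and halving divides each p-th power sum
   by at least 2, so [u] stays in the ball. *)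
pose u : d.-tuple R := [tuple (tnth (spike d k a) i + tnth v i) / 2 | i < d].
have half_lt y0 : 0 <= y0 -> (y0 / 2) `^ p <= y0 `^ p / 2.
  move=> y00; rewrite powRM ?invr_ge0// ler_wpM2l ?powR_ge0//.
  rewrite -[leRHS]powR_inv1 ?powR_inv1//.
  by apply: ge1r_powR => //; lra.
have uB : lp_ball p u.
  apply/lp_ballE => //; rewrite (bigID S)/=.
  have : \sum_(i < d | S i) `|tnth u i| `^ p <= 1 / 2.
    rewrite (_ : 1 / 2 = k%:R * (a `^ p / 2)); last by rewrite mulrA ka.
    rewrite -(@sum_ord_lt d)//; apply: ler_sum => i Si.
    rewrite tnth_mktuple spS// vS// addr0 gtr0_norm ?divr_gt0//.
    exact/half_lt/ltW.
  have : \sum_(i < d | ~~ S i) `|tnth u i| `^ p <= 1 / 2.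
    have : \sum_(i < d | ~~ S i) `|tnth v i| `^ p <= 1.
      apply: le_trans v1; rewrite [leRHS](bigID S)/= lerDr.
      by apply: sumr_ge0 => i _; exact: powR_ge0.
    rewrite -(ler_pM2r (_ : 0 < 2^-1)) ?invr_gt0//; apply: le_trans.
    rewrite mulr_suml; apply: ler_sum => i Si.
    rewrite tnth_mktuple spNS// add0r normrM (gtr0_norm (_ : 0 < 2^-1)) ?invr_gt0//.
    exact: half_lt.
  lra.
(* Minimality makes the difference of the two squared distances to [y] nonnegative; bounding it
   coordinatewise, on and off [S], shows that it is negative. *)
have := xmin u uB.
have -> : sqdist x y = \sum_(i < d) (h i - w i) ^+ 2.
  by apply: eq_bigr => i _; rewrite /h /w; ring.
have -> : sqdist u y =
    \sum_(i < d) ((tnth v i - tnth (spike d k a) i) / 2 - w i) ^+ 2.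
  by apply: eq_bigr => i _; rewrite /w tnth_mktuple; field.
rewrite -subr_ge0 -sumrB.
suff : \sum_(i < d) (((tnth v i - tnth (spike d k a) i) / 2 - w i) ^+ 2 -
    (h i - w i) ^+ 2) < 0 by rewrite ltNge => /negP.
rewrite (bigID S)/=.
have HS : \sum_(i < d | S i) (((tnth v i - tnth (spike d k a) i) / 2 - w i) ^+ 2 -
    (h i - w i) ^+ 2) <= \sum_(i < d | S i) (3 / 4 * a ^+ 2 + 3 / 2 * w i ^+ 2 + h i ^+ 2).
  apply: ler_sum => i Si; rewrite vS// spS//.
  have := sqr_ge0 (a - w i); have := sqr_ge0 (h i - w i); have := sqr_ge0 (h i).
  nra.
have HN : \sum_(i < d | ~~ S i) (((tnth v i - tnth (spike d k a) i) / 2 - w i) ^+ 2 -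
    (h i - w i) ^+ 2) <=
    \sum_(i < d | ~~ S i) (tnth v i ^+ 2 - w i * tnth v i + 2 * (w i * tnth x i)).
  apply: ler_sum => i Si; rewrite /h spNS//.
  have := sqr_ge0 (tnth v i); have := sqr_ge0 (tnth x i).
  nra.
have T0 : 0 <= k%:R * a ^+ 2 by rewrite mulr_ge0// sqr_ge0.
(* This uses [s <= a]. The coordinates in [S] then cost at most 3/4 + (3/2) 32 + 1 = 49.75 times
   [k%:R * a ^+ 2], which the 51 covers. *)
have ws : \sum_(i < d | S i) w i ^+ 2 <= 32 * (k%:R * a ^+ 2).
  apply: (le_trans wS); rewrite -mulrA ler_pM2l// ler_wpM2l//.
  by rewrite lerXn2r ?nnegrE// ltW.
have he : e ^+ 2 * (k%:R * a ^+ 2) <= k%:R * a ^+ 2.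
  by rewrite ler_piMl// expr_le1// ltW.
move: HS; rewrite !big_split/= sum_ord_lt// -mulr_sumr => HS.
move: HN; rewrite !big_split/= sumrN -mulr_sumr => HN.
have sv : \sum_(i < d | ~~ S i) tnth v i ^+ 2 <= \sum_(i < d) tnth v i ^+ 2.
  rewrite [leRHS](bigID S)/= lerDr.
  by apply: sumr_ge0 => i _; exact: sqr_ge0.
have sw : \sum_(i < d) w i * tnth v i = \sum_(i < d | ~~ S i) w i * tnth v i.
  rewrite (bigID S)/= big1 ?add0r// => i Si; rewrite vS ?mulr0//.
have sN : \sum_(i < d | ~~ S i) - (w i * tnth v i) =
  - \sum_(i < d | ~~ S i) w i * tnth v i by rewrite sumrN.
rewrite sw in HG; rewrite sN in HN.
move: HG HS HN sv ws he hS wx.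
set A1 := k%:R * a ^+ 2; set A2 := \sum_(i < d | S i) w i ^+ 2.
have -> : k%:R * (3 / 4 * a ^+ 2) = 3 / 4 * A1 by rewrite /A1; ring.
set A3 := \sum_(i < d | S i) h i ^+ 2.
have -> : 2 * m * B = 2 * (m * B) by ring.
move: (m * B) => mB; rewrite -/A1 in T0.
move: (\sum_(i < d | ~~ S i) w i * tnth x i) => wx.
lra.
Qed.

End deterministic.

(** * Lower bound on the risk of the MLE *)

Section risk.
Context {R : realType}.

(* Spares us the measurability of the projection, whose risk is only bounded
   from below. *)
Lemma ge0_le_integral_nonmeasurable d (T : measurableType d)
    (mu : {measure set T -> \bar R}) (f g : T -> \bar R) :
  (forall x, 0 <= f x)%E -> (forall x, f x <= g x)%E ->
  (\int[mu]_x f x <= \int[mu]_x g x)%E.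
Proof.
move=> f0 fg; rewrite !ge0_integralTE//; last by move=> x; exact: le_trans (fg x).
apply: ereal_sup_le => _ [h /= hf <-].
by exists h => // x; exact: le_trans (fg x).
Qed.

(** Markov's inequality in integrated form: [r * (F y < 1) + r * F y] is at least [r] pointwise, and
    the second term integrates to at most [r / 2]. *)
Lemma worst_risk_ge d (Theta : set (d.-tuple R)) s est theta
    (F : d.-tuple R -> R) (r : R) :
  Theta theta -> 0 <= r ->
  measurable_fun [set: d.-tuple R] F -> (forall y, 0 <= F y) ->
  (\int[gaussian theta s]_y (F y)%:E <= (2^-1)%:E)%E ->
  (forall y, F y < 1 -> r <= sqdist (est y) theta) ->
  ((r / 2)%:E <= worst_risk Theta s est)%E.
Proof.
move=> Tt r0 mF F0 IF HF.
apply: (@le_trans _ _ 'E_(gaussian theta s)[(fun Y => sqdist (est Y) theta)]%E).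
  rewrite unlock.
  pose f y : R := r * (F y < 1)%R%:R.
  have mf : measurable_fun [set: d.-tuple R] f.
    apply: measurable_funM => //.
    rewrite (_ : (fun x => _) = \1_[set y | F y < 1]); last first.
      by apply/funext => x; rewrite indicE mem_setE.
    apply: measurable_indic.
    rewrite (_ : [set y | _] = F @^-1` `]-oo, 1[); last first.
      by apply/seteqP; split => y; rewrite /= in_itv.
    by rewrite -[X in measurable X]setTI; exact: mF.
  have f0 y : 0 <= f y by rewrite mulr_ge0.
  apply: (@le_trans _ _ (\int[gaussian theta s]_y (f y)%:E)%E); last first.
    apply: ge0_le_integral_nonmeasurable => y; first by rewrite lee_fin.
    rewrite lee_fin /f; case: ltP => [/HF|_]; first by rewrite mulr1.
    by rewrite mulr0; apply: sumr_ge0 => i _; exact: sqr_ge0.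
  have : (r%:E <= \int[gaussian theta s]_y (f y + r * F y)%:E)%E.
    rewrite -[leLHS]mule1 -(@probability_setT _ _ _ (gaussian theta s)) -integral_cst//.
    apply: ge0_le_integral => //.
    - apply/measurable_EFinP; apply: measurable_funD => //.
      exact: measurable_funM.
    - move=> y _; rewrite lee_fin /f; case: ltP => Fy.
        by rewrite mulr1 lerDl mulr_ge0.
      by rewrite mulr0 add0r ler_peMr.
  under eq_integral do rewrite EFinD.
  rewrite ge0_integralD//; last 4 first.
  - by move=> y _; rewrite lee_fin.
  - exact/measurable_EFinP.
  - by move=> y _; rewrite lee_fin mulr_ge0.
  - by apply/measurable_EFinP; exact: measurable_funM.
  under [X in (_ <= _ + X)%E -> _]eq_integral do rewrite EFinM.
  rewrite ge0_integralZl//; last 2 first.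
  - exact/measurable_EFinP.
  - by move=> y _; rewrite lee_fin.
  move=> H.
  have {}H := le_trans H (leeD2l _ (lee_wpmul2l (_ : (0 <= r%:E)%E) IF)).
  have : (r%:E <= \int[gaussian theta s]_y (f y)%:E + (r * 2^-1)%:E)%E.
    by rewrite EFinM; apply: H; rewrite lee_fin.
  rewrite -leeBlDr// -EFinB; apply: le_trans.
  by rewrite lee_fin; lra.
by apply: ereal_sup_ubound; exists theta.
Qed.

Lemma integral_sum_tnth d (theta : d.-tuple R) s (S : pred 'I_d) (g : 'I_d -> R -> R) :
  (forall i, measurable_fun [set: R] (g i)) -> (forall i x, 0 <= g i x) ->
  (\int[gaussian theta s]_y (\sum_(i < d | S i) g i (tnth y i))%:E =
   \sum_(i < d | S i) \int[normal_law (tnth theta i) s]_x (g i x)%:E)%E.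
Proof.
move=> mg g0; under eq_integral do rewrite big_mkcond -sumEFin.
rewrite [RHS]big_mkcond ge0_integral_sum//; last 2 first.
- move=> i; apply/measurable_EFinP; case: (S i) => //.
  exact: (measurableT_comp (mg i) (measurable_tnth i)).
- by move=> i y _; rewrite lee_fin; case: ifP.
apply: eq_bigr => i _; case: (S i); last by rewrite integral0.
by rewrite /gaussian prod_prob_marginal.
Qed.

Lemma normal_law_le_exp_moment m s (g : R -> R) K : 0 < s ->
  measurable_fun [set: R] g -> (forall x, 0 <= g x) ->
  (forall x, g x <= K * exp_moment m s x) ->
  (\int[normal_law m s]_x (g x)%:E <= (2 * K)%:E)%E.
Proof.
move=> s0 mg g0 gK.
have K0 : 0 <= K.
  have := le_trans (g0 0) (gK 0); rewrite pmulr_lge0//; exact: expR_gt0.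
rewrite mulrC EFinM -(@normal_law_exp_moment R m s s0) -ge0_integralZl//; last 2 first.
- by apply/measurable_EFinP; exact: measurable_exp_moment.
- by move=> x _; rewrite lee_fin expR_ge0.
apply: ge0_le_integral => //.
- by move=> x _; rewrite lee_fin.
- exact/measurable_EFinP.
- apply/measurable_EFinP; apply: measurable_funM => //; exact: measurable_exp_moment.
- by move=> x _; rewrite lee_fin.
Qed.

Lemma sqr_le_exp_moment (m s x : R) : ((x - m) / s) ^+ 2 <= 8 / 3 * exp_moment m s x.
Proof.
have := expR_ge1Dx (3 / 8 * ((x - m) / s) ^+ 2).
rewrite -/(exp_moment m s x); lra.
Qed.

(* F is a sum of three quantities to which Markov's inequality applies; one of
   them is 2^(m - N), where N counts the coordinates i >= k with noise at least
   t s, so that F < 1 forces N > m. *)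
Lemma good_event d k (theta : d.-tuple R) s (g : R -> R) (K t r : R) :
  0 < s -> (0 < k)%N -> (k <= d)%N -> 0 < K -> 
  measurable_fun [set: R] g -> (forall x, 0 <= g x) ->
  (forall x, g x <= K * expR (3 / 8 * x ^+ 2)) ->
  0 <= t -> 0 <= r -> r <= expR (- (t + 1) ^+ 2 / 2) / 3 ->
  20 <= (d - k)%:R * r ->
  exists F : d.-tuple R -> R, [/\ measurable_fun [set: d.-tuple R] F,
    (forall y, 0 <= F y),
    (\int[gaussian theta s]_y (F y)%:E <= (2^-1)%:E)%E &
    forall y, F y < 1 -> [/\
      \sum_(i < d | (i < k)%N) (tnth y i - tnth theta i) ^+ 2 <= 32 * k%:R * s ^+ 2,
      (d - k)%:R * r / 5 <=
        #|[pred i : 'I_d | (k <= i)%N && (t * s <= `|tnth y i - tnth theta i|)]|%:R &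
      \sum_(i < d) g ((tnth y i - tnth theta i) / s) <= 12 * K * d%:R]].
Proof.
move=> s0 k0 kd K0 mg g0 gK t0 r0 rt dr.
have d0 : (0 < d)%N by exact: leq_trans kd.
pose z i (x : R) := (x - tnth theta i) / s.
have mz i : measurable_fun [set: R] (z i).
  by apply: measurable_funM => //; exact: measurable_funB.
(* The normalizations 32 and [12 * K] give [F1] and [F3] mean at most 1/6, since the exponential
   weight integrates to 2. *)
pose F1 (y : d.-tuple R) := \sum_(i < d | (i < k)%N) z i (tnth y i) ^+ 2 / (32 * k%:R).
pose F3 (y : d.-tuple R) := \sum_(i < d) g (z i (tnth y i)) / (12 * K * d%:R).
pose b i (x : R) : R := (t * s <= `|x - tnth theta i|)%R%:R.
have mb i : measurable_fun [set: R] (b i).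
  rewrite (_ : b i = \1_[set x | t * s <= `|x - tnth theta i|]); last first.
    by apply/funext => x; rewrite indicE mem_setE.
  apply: measurable_indic.
  rewrite -[X in measurable X]setTI; apply: measurable_fun_le => //.
  by apply: measurableT_comp => //; exact: measurable_funB.
have b01 i x : 0 <= b i x <= 1 by rewrite /b; case: (_ <= `|_|); rewrite /= ?ler01 ?lexx.
(* The factor is 1/2 at a large noise coordinate and 1 elsewhere, so that the product equals
   2^(-N). *)
pose f (i : 'I_d) x := if (k <= i)%N then 1 - b i x / 2 else 1.
have f0 i x : 0 <= f i x.
  rewrite /f; case: ifP => // _; have := b01 i x; lra.
have mf i : measurable_fun [set: R] (f i).
  rewrite /f; case: (k <= i)%N => //.
  by apply: measurable_funB => //; exact: measurable_funM.
(* The mean of 2^(-N) is at most exp(- (d - k) r / 2), while 2^m <= e^m <= exp((d - k) r / 4). The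
   product is at most exp(-5) <= 1/6, because (d - k) r >= 20. *)
pose m := Num.truncn ((d - k)%:R * r / 4).
have x0 : 0 <= (d - k)%:R * r / 4 by lra.
have /andP[m1 m2] := truncn_itv x0.
rewrite -/m in m1 m2.
pose F2 (y : d.-tuple R) := 2 ^+ m * \prod_(i < d) f i (tnth y i).
have mtn (h : R -> R) i : measurable_fun [set: R] h ->
    measurable_fun [set: d.-tuple R] (fun y => h (tnth y i)).
  by move=> mh; exact: (measurableT_comp mh (measurable_tnth i)).
have mF1 : measurable_fun [set: d.-tuple R] F1.
  have -> : F1 = (fun y => \sum_(i < d)
      if (i < k)%N then z i (tnth y i) ^+ 2 / (32 * k%:R) else 0).
    by apply/funext => y; rewrite /F1 big_mkcond.
  apply: measurable_sum => i; case: (i < k)%N => //.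
  apply: measurable_funM => //; apply: measurable_funX; exact: mtn.
have mF2 : measurable_fun [set: d.-tuple R] F2.
  apply: measurable_funM => //; exact: measurable_prod_tnth.
have mF3 : measurable_fun [set: d.-tuple R] F3.
  apply: measurable_sum => i; apply: measurable_funM => //.
  apply: (mtn (g \o z i)); exact: measurableT_comp.
have F10 y : 0 <= F1 y.
  by apply: sumr_ge0 => i _; rewrite divr_ge0 ?sqr_ge0.
have F20 y : 0 <= F2 y by rewrite mulr_ge0 ?exprn_ge0 ?prodr_ge0.
have c30 : 0 < 12 * K * d%:R by rewrite !mulr_gt0// ltr0n.
have F30 y : 0 <= F3 y.
  by apply: sumr_ge0 => i _; rewrite divr_ge0// ltW.
have kpos : 0 < k%:R :> R by rewrite ltr0n.
have dpos : 0 < d%:R :> R by rewrite ltr0n.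
have I1 : (\int[gaussian theta s]_y (F1 y)%:E <= (6^-1)%:E)%E.
  rewrite (integral_sum_tnth _ _ _ (g := fun i x => z i x ^+ 2 / (32 * k%:R))); last 2 first.
  - by move=> i; apply: measurable_funM => //; exact: measurable_funX.
  - by move=> i x; rewrite divr_ge0 ?sqr_ge0.
  apply: (@le_trans _ _ (\sum_(i < d | (i < k)%N) (2 * (8 / 3 / (32 * k%:R)))%:E)%E).
    apply: lee_sum => i _; apply: normal_law_le_exp_moment => //.
    - by apply: measurable_funM => //; exact: measurable_funX.
    - by move=> x; rewrite divr_ge0 ?sqr_ge0.
    - move=> x; rewrite [leRHS]mulrAC ler_pM2r ?invr_gt0 ?mulr_gt0//.
      exact: sqr_le_exp_moment.
  rewrite sumEFin sum_ord_lt// lee_fin le_eqVlt; apply/orP; left; apply/eqP.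
  by field; rewrite gt_eqF.
have I3 : (\int[gaussian theta s]_y (F3 y)%:E <= (6^-1)%:E)%E.
  rewrite (integral_sum_tnth _ _ _ (g := fun i x => g (z i x) / (12 * K * d%:R))); last 2 first.
  - by move=> i; apply: measurable_funM => //; exact: measurableT_comp.
  - by move=> i x; rewrite divr_ge0// ltW.
  apply: (@le_trans _ _ (\sum_(i < d) (2 * (K / (12 * K * d%:R)))%:E)%E).
    apply: lee_sum => i _; apply: normal_law_le_exp_moment => //.
    - by apply: measurable_funM => //; exact: measurableT_comp.
    - by move=> x; rewrite divr_ge0// ltW.
    - by move=> x; rewrite [leRHS]mulrAC ler_pM2r ?invr_gt0//.
  rewrite sumEFin sumr_const card_ord lee_fin -[_ *+ d]mulr_natl.
  rewrite le_eqVlt; apply/orP; left; apply/eqP.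
  by field; rewrite !gt_eqF.
have I2 : (\int[gaussian theta s]_y (F2 y)%:E <= (6^-1)%:E)%E.
  under eq_integral do rewrite EFinM.
  rewrite ge0_integralZl//; last 2 first.
  - by apply/measurable_EFinP; exact: measurable_prod_tnth.
  - by move=> y _; rewrite lee_fin prodr_ge0.
  rewrite /gaussian prod_prob_integral//.
  pose c := expR (- (r / 2)).
  have H i : (\int[normal_law (tnth theta i) s]_x (f i x)%:E <=
     (if (k <= i)%N then c else 1)%:E)%E.
    rewrite /f; case: (k <= i)%N; last first.
      by rewrite integral_cst//= mul1e probability_setT.
    have tail := normal_law_tail (tnth theta i) s0 t0.
    have E1 : (\int[normal_law (tnth theta i) s]_x (1 - b i x / 2)%:E +
        2^-1%:E * \int[normal_law (tnth theta i) s]_x (b i x)%:E = 1)%E.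
      rewrite -ge0_integralZl//; last 2 first.
      - exact/measurable_EFinP.
      - by move=> x _; rewrite lee_fin; have /andP[] := b01 i x.
      rewrite -ge0_integralD//; last 4 first.
      - by move=> x _; rewrite lee_fin; have := b01 i x; clear; lra.
      - apply/measurable_EFinP; apply: measurable_funB => //; exact: measurable_funM.
      - by move=> x _; rewrite -EFinM lee_fin; have := b01 i x; clear; lra.
      - apply/measurable_EFinP; exact: measurable_funM.
      rewrite -[RHS](@probability_setT _ _ _ (normal_law (tnth theta i) s)).
      rewrite -[RHS]mul1e -integral_cst//.
      apply: eq_integral => x _; rewrite -EFinM -EFinD; congr EFin; clear; lra.
    move: E1 tail.
    set I1' := integral _ _ _; set I2' := integral _ _ _ => E1 tail.
    have I1p : (0 <= I1')%E.
      by apply: integral_ge0 => x _; rewrite lee_fin; have := b01 i x; clear; lra.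
    have I2p : (r%:E <= I2')%E by apply: le_trans tail; rewrite lee_fin.
    clear tail; clearbody I1' I2'.
    (* The relation [I1' + I2' / 2 = 1] excludes infinite values; for finite ones
       [I1' <= 1 - r / 2 <= c]. *)
    move: E1 I1p I2p; case: I1' => [u| |]; case: I2' => [v| |] //=.
    + rewrite -EFinM -EFinD !lee_fin => -[uv] u0 rv.
      have := expR_ge1Dx (- (r / 2)); rewrite -/c; lra.
    + by rewrite gt0_muley// lte_fin.
    + by rewrite gt0_muley// lte_fin.
  apply: (@le_trans _ _ ((2 ^+ m)%:E * (\prod_(i < d) (if (k <= i)%N then c else 1))%:E)%E).
    apply: lee_wpmul2l; first by rewrite lee_fin exprn_ge0.
    apply: (proj2 (big_ind2 (fun (u : \bar R) v => (0 <= u)%E /\ (u <= v%:E)%E)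
      _ _ _)) => [|u u' v v' [u0 uu'] [v0 vv']|i _].
    - by rewrite lee_fin ler01.
    - by split; [exact: mule_ge0 | rewrite EFinM lee_pmul].
    - by split=> //; apply: integral_ge0 => x _; rewrite lee_fin.
  rewrite -EFinM lee_fin -big_mkcond/= prodr_const.
  have -> : #|[pred i : 'I_d | (k <= i)%N]| = (d - k)%N.
    rewrite -[in RHS](card_ord d) -(cardC [pred i : 'I_d | (i < k)%N]).
    rewrite (_ : #|[pred i : 'I_d | (i < k)%N]| = k); last first.
      by rewrite -sum1_card -(big_ord_widen d (fun=> 1%N))// sum_nat_const card_ord muln1.
    by rewrite addKn; apply: eq_card => i; rewrite !inE -leqNgt.
  rewrite /c -expRM_natl.
  have two : (2 : R) ^+ m <= expR m%:R.
    rewrite -[m%:R]mulr1 expRM_natl lerXn2r ?nnegrE ?expR_ge0//.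
    by have := expR_ge1Dx (1 : R); clear; lra.
  have : 2 ^+ m * expR ((d - k)%:R * - (r / 2)) <= expR (- ((d - k)%:R * r / 4)).
    apply: (le_trans (ler_wpM2r (expR_ge0 _) two)).
    by rewrite -expRD ler_expR; move: m1; clear; lra.
  move=> /le_trans; apply; rewrite expRN lef_pV2 ?posrE ?expR_gt0//.
  by apply: le_trans (expR_ge1Dx _); move: dr; clear; lra.
exists (fun y => F1 y + F2 y + F3 y); split.
- by apply: measurable_funD => //; exact: measurable_funD.
- by move=> y; rewrite !addr_ge0.
- under eq_integral do rewrite !EFinD.
  rewrite ge0_integralD//; last 4 first.
  - by move=> y _; rewrite -EFinD lee_fin addr_ge0.
  - by apply/measurable_EFinP; exact: measurable_funD.
  - by move=> y _; rewrite lee_fin.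
  - exact/measurable_EFinP.
  rewrite ge0_integralD//; last 4 first.
  - by move=> y _; rewrite lee_fin.
  - exact/measurable_EFinP.
  - by move=> y _; rewrite lee_fin.
  - exact/measurable_EFinP.
  apply: (le_trans (leeD (leeD I1 I2) I3)).
  by rewrite -!EFinD lee_fin; clear; lra.
- move=> y Fy; have {Fy} : [/\ F1 y < 1, F2 y < 1 & F3 y < 1].
    move: (F10 y) (F20 y) (F30 y) Fy.
    by move: (F1 y) (F2 y) (F3 y); clear; split; lra.
  case=> h1 h2 h3; split.
  + move: h1; rewrite /F1 -mulr_suml ltr_pdivrMr ?mulr_gt0// mul1r => /ltW.
    rewrite -(ler_pM2r (exprn_gt0 2 s0)) mulr_suml; apply: le_trans.
    rewrite le_eqVlt; apply/orP; left; apply/eqP; apply: eq_bigr => i _.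
    by rewrite -exprMn divfK// gt_eqF.
  + set A := [pred i : 'I_d | _].
    have : 2 ^+ m * (2^-1 ^+ #|A|) < 1 :> R.
      move: h2; rewrite /F2; congr (_ * _ < _).
      rewrite -prodr_const [RHS]big_mkcond/=; apply: eq_bigr => i _.
      rewrite /f /b /A inE; case: (k <= i)%N => //=.
      case: (_ <= `|_|) => /=; clear; lra.
    rewrite exprVn -ltr_pdivlMr ?invr_gt0 ?exprn_gt0// invrK mul1r.
    (* N > m means N >= m + 1 > (d - k) r / 4. *)
    rewrite ltr_eXn2l ?ltr1n// => mA.
    have : (m.+1%:R <= #|A|%:R :> R) by rewrite ler_nat.
    lra.
  + by move: h3; rewrite /F3 -mulr_suml ltr_pdivrMr// mul1r => /ltW.
Qed.

End risk.

(** * Test directions aligned with the noise, and the two lower bounds on the risk of the MLE *)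

Section mle_lower.
Context {R : realType}.

(** For [|x| > 1] raise the exponent to an even integer [2 n] and compare with the [n]-th term of
    the exponential series. This supplies the constant [K] for the q-th moment of the noise. *)
Lemma powR_le_expR_sqr (q : R) : 0 <= q ->
  exists2 K, 0 < K & forall x : R, `|x| `^ q <= K * expR (3 / 8 * x ^+ 2).
Proof.
move=> q0; pose n := (Num.truncn q).+1.
have qn : q <= n%:R by have /andP[_ /ltW] := truncn_itv q0.
pose c : R := n`!%:R * (8 / 3) ^+ n.
have c0 : 0 <= c by rewrite mulr_ge0// exprn_ge0.
exists (1 + c); first by rewrite ltr_wpDr.
move=> x.
have e1 : 1 <= expR (3 / 8 * x ^+ 2).
  by rewrite -expR0 ler_expR mulr_ge0 ?sqr_ge0.
have [x1|x1] := leP `|x| 1.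
  apply: (@le_trans _ _ 1); last first.
    by rewrite -[leLHS]mulr1 ler_pM// lerDl.
  by have := @ge0_ler_powR R q q0 _ _ (normr_ge0 x) ler01 x1; rewrite powR1.
apply: (@le_trans _ _ (c * expR (3 / 8 * x ^+ 2))); last first.
  by rewrite ler_wpM2r ?expR_ge0// lerDr.
apply: (@le_trans _ _ ((x ^+ 2) ^+ n)).
  rewrite -real_normK ?num_real// -exprM -powR_mulrn//.
  apply: ler_powR; first exact: ltW.
  by rewrite (le_trans qn)// ler_nat leq_pmull.
have y0 : 0 <= 3 / 8 * x ^+ 2 by rewrite mulr_ge0 ?sqr_ge0.
have := expR_ge1Dxn (Num.truncn q) y0.
rewrite -/n.
have fp : 0 < n`!%:R :> R by rewrite ltr0n fact_gt0.
have -> : (x ^+ 2) ^+ n = c * ((3 / 8 * x ^+ 2) ^+ n / n`!%:R).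
  rewrite /c [RHS]mulrC mulrA divfK ?gt_eqF// -exprMn.
  by congr (_ ^+ n); field.
move=> H; rewrite ler_wpM2l//; apply: le_trans H; rewrite lerDr//.
Qed.

(** Young's inequality applied termwise to [x i] and [w i / W]; the two sums then contribute at most
    [1 / p] and [1 / q]. *)
Lemma sum_mul_le_hoelder d (w x : 'I_d -> R) p q W : 0 < p -> 0 < q ->
  p^-1 + q^-1 = 1 -> 0 < W ->
  \sum_(i < d) `|w i| `^ q <= W `^ q -> \sum_(i < d) `|x i| `^ p <= 1 ->
  \sum_(i < d) w i * x i <= W.
Proof.
move=> p0 q0 pq W0 Hw Hx.
have step i : w i * x i <= W * (`|x i| `^ p / p + `|w i| `^ q / W `^ q / q).
  apply: (le_trans (ler_norm _)); rewrite normrM.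
  have -> : `|w i| * `|x i| = W * (`|x i| * (`|w i| / W)).
    by field; rewrite gt_eqF.
  rewrite ler_pM2l//.
  have wW : 0 <= `|w i| / W by rewrite divr_ge0// ltW.
  apply: (le_trans (conjugate_powR (normr_ge0 (x i)) wW p0 q0 pq)).
  rewrite lerD2l ler_pM2r ?invr_gt0// powRM ?invr_ge0 ?(ltW W0)//.
  by rewrite -(powR_inv1 (ltW W0)) -powRrM mulN1r powRN.
apply: (le_trans (ler_sum _ (fun i _ => step i))).
rewrite -mulr_sumr -[leRHS]mulr1 ler_pM2l// big_split/= -!mulr_suml -pq.
have Wq : 0 < W `^ q by rewrite powR_gt0.
by rewrite lerD// -[leRHS]mul1r ler_pM2r ?invr_gt0// ler_pdivrMr// mul1r.
Qed.

(** The sign pattern of [w] on [A], at the height that gives l_p norm 1 when [w] does not vanish on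
    [A]. *)
Definition flat_vector d (A : pred 'I_d) (w : 'I_d -> R) p : d.-tuple R :=
  [tuple if A i then Num.sg (w i) * #|A|%:R `^ - p^-1 else 0 | i < d].

Lemma flat_vectorP d (A : pred 'I_d) (w : 'I_d -> R) p c
  (v := flat_vector A w p) : 0 < p -> (0 < #|A|)%N ->
  (forall i, A i -> c <= `|w i|) ->
  [/\ \sum_(i < d) `|tnth v i| `^ p <= 1,
      \sum_(i < d) tnth v i ^+ 2 <= #|A|%:R `^ (1 - 2 / p) &
      c * #|A|%:R `^ (1 - p^-1) <= \sum_(i < d) w i * tnth v i].
Proof.
move=> p0 A0 Ac.
have n0 : 0 < #|A|%:R :> R by rewrite ltr0n.
set n := #|A|%:R in n0 *.
have nn0 : (n != 0) by rewrite gt_eqF.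
set b := n `^ - p^-1; have b0 : 0 < b by rewrite powR_gt0.
have sg1 x : `|Num.sg x| <= 1 :> R by rewrite normr_sg; case: eqP.
have sumA (x : R) : \sum_(i < d | A i) x = n * x.
  by rewrite sumr_const -/n mulr_natl.
have sumif (F : 'I_d -> R -> R) : (forall i, F i 0 = 0) ->
    \sum_(i < d) F i (tnth v i) = \sum_(i < d | A i) F i (Num.sg (w i) * b).
  move=> F0; rewrite [RHS]big_mkcond; apply: eq_bigr => i _.
  by rewrite tnth_mktuple; case: (A i).
split.
- rewrite (sumif (fun _ x => `|x| `^ p)); last first.
    by move=> _; rewrite normr0 powR0// gt_eqF.
  apply: (@le_trans _ _ (\sum_(i < d | A i) b `^ p)).
    apply: ler_sum => i _; rewrite ge0_ler_powR ?nnegrE ?(ltW p0) ?(ltW b0)//.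
    by rewrite normrM (gtr0_norm b0) ler_piMl// ltW.
  rewrite sumA /b -powRrM mulNr mulVf ?gt_eqF// powR_inv1 ?(ltW n0)//.
  by rewrite divff.
- rewrite (sumif (fun _ x => x ^+ 2)); last by move=> _; rewrite expr0n.
  apply: (@le_trans _ _ (\sum_(i < d | A i) b ^+ 2)).
    apply: ler_sum => i _; rewrite -real_normK ?num_real//.
    rewrite lerXn2r ?nnegrE ?(ltW b0)//.
    by rewrite normrM (gtr0_norm b0) ler_piMl// ltW.
  rewrite sumA -powR_mulrn ?(ltW b0)// /b -powRrM -{1}(powRr1 (ltW n0)) -powRD//.
    by rewrite mulNr [_^-1 * _]mulrC.
  by rewrite nn0 implybT.
- rewrite (sumif (fun i x => w i * x)); last by move=> i; rewrite mulr0.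
  apply: (@le_trans _ _ (\sum_(i < d | A i) c * b)).
    rewrite sumA mulrCA powRD ?nn0 ?implybT// powRr1 ?(ltW n0)//.
  apply: ler_sum => i Ai; rewrite mulrA -[w i * _]mulrC -normrEsg ler_pM2r//.
  exact: Ac.
Qed.

(** Combines [good_event] at threshold [t = 1], hence the value of [r], with [projection_far]. The
    bound [B] comes from Hoelder's inequality and the q-th moment of the noise; [v] is flat on the
    coordinates off the spike with noise at least [s], of which there are at least [d * r / 10]
    because [2 k <= d]. *)
Lemma mle_risk_ge_flat d k p q K a s e (r := expR (- 2) / 3) :
  1 < p <= 2 -> 0 < q -> p^-1 + q^-1 = 1 ->
  0 < K -> (forall x : R, `|x| `^ q <= K * expR (3 / 8 * x ^+ 2)) ->
  0 < a -> 0 < s <= a -> 0 < e <= 1 -> (0 < k)%N -> (k.*2 <= d)%N ->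
  k%:R * a `^ p = 1 -> 40 <= d%:R * r ->
  2 * (2 * e) `^ p^-1 * (s * (12 * K * d%:R) `^ q^-1) + 51 * (k%:R * a ^+ 2)
    + (d%:R * r / 10) `^ (1 - 2 / p) < s * (d%:R * r / 10) `^ (1 - p^-1) ->
  ((e ^+ 2 * (k%:R * a ^+ 2) / 2)%:E <= mle_risk (@lp_ball R d p) s)%E.
Proof.
move=> /andP[p1 p2] q0 pq K0 HK a0 sa e01 k0 kd ka dr cond.
have p0 : 0 < p by rewrite (lt_trans _ p1).
have s0 : 0 < s by case/andP: sa.
have r0 : 0 < r by rewrite divr_gt0 ?expR_gt0.
have kled : (k <= d)%N by rewrite (leq_trans _ kd)// -addnn leq_addr.
have dk2 : d%:R / 2 <= (d - k)%:R :> R.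
  rewrite natrB//; have : (k.*2)%:R <= d%:R :> R by rewrite ler_nat.
  rewrite -mul2n natrM; lra.
have dk : 20 <= (d - k)%:R * r.
  have : d%:R / 2 * r <= (d - k)%:R * r by rewrite ler_pM2r.
  lra.
have rt : r <= expR (- (1 + 1) ^+ 2 / 2) / 3.
  by rewrite /r (_ : - (1 + 1) ^+ 2 / 2 = - 2 :> R)//; field.
pose g (x : R) := `|x| `^ q.
have mg : measurable_fun [set: R] g.
  apply: (@measurableT_comp _ _ _ _ _ _ (@powR R ^~ q)) => //.
have g0 x : 0 <= g x by exact: powR_ge0.
have [F [mF F0 IF HF]] := @good_event R d k (spike d k a) s g K 1 r s0 k0 kled K0
  mg g0 HK ler01 (ltW r0) rt dk.
apply: (@worst_risk_ge _ _ _ _ _ (spike d k a) F) => //.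
- by apply: spike_lp_ball => //; rewrite ka.
- by rewrite mulr_ge0 ?sqr_ge0// mulr_ge0 ?sqr_ge0.
move=> y /HF[wS nA gq]; apply: ltW.
pose w i := tnth y i - tnth (spike d k a) i.
pose A : pred 'I_d := [pred i : 'I_d | (k <= i)%N && (1 * s <= `|w i|)].
have An : d%:R * r / 10 <= #|A|%:R.
  apply: le_trans nA.
  have : d%:R / 2 * r <= (d - k)%:R * r by rewrite ler_pM2r.
  lra.
have dr0 : 0 < d%:R * r / 10 by move: dr; clear; lra.
have A0 : (0 < #|A|)%N by rewrite -(ltr0n R) (lt_le_trans dr0).
have Ac i : A i -> s <= `|w i| by move=> /andP[_]; rewrite mul1r.
have [v1 v2 v3] := flat_vectorP p0 A0 Ac.
set v := flat_vector A w p in v1 v2 v3.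
have W0 : 0 < s * (12 * K * d%:R) `^ q^-1.
  rewrite mulr_gt0// powR_gt0// mulr_gt0 ?mulr_gt0//.
  by rewrite ltr0n (leq_trans k0).
apply: (@projection_far R d k p a s e (s * (12 * K * d%:R) `^ q^-1) y v) => //.
- by rewrite (ltW p1).
- by move=> i ik; rewrite tnth_mktuple /A /= leqNgt ik.
- move=> x _ x1.
  apply: (@sum_mul_le_hoelder d w (fun i => tnth x i) p q) => //.
  rewrite powRM ?(ltW s0) ?powR_ge0// -powRrM mulVf ?gt_eqF// powRr1; last first.
    by rewrite mulr_ge0// mulr_ge0// ltW.
  have sq : 0 < s `^ q by rewrite powR_gt0.
  rewrite -ler_pdivrMl// mulrC mulr_suml; apply: le_trans gq.
  rewrite le_eqVlt; apply/orP; left; apply/eqP; apply: eq_bigr => i _.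
  rewrite /g -/(w i) normrM normfV (gtr0_norm s0) powRM ?invr_ge0 ?(ltW s0)//.
  by rewrite -(powR_inv1 (ltW s0)) -powRrM mulN1r powRN.
(* The exponent [1 - 2 / p] is nonpositive and [1 - p^-1] positive, so the lower bound on [#|A|]
   helps in both places. *)
- apply: lt_le_trans v3; apply: le_lt_trans (lt_le_trans cond _).
    rewrite lerD2l; apply: (le_trans v2).
    have e0 : 0 <= 2 / p - 1 by rewrite subr_ge0 ler_pdivlMr// mul1r.
    rewrite -(opprB _ 1) !powRN lef_pV2 ?posrE ?powR_gt0 ?ltr0n//.
    by rewrite ge0_ler_powR// ?nnegrE ?(ltW dr0)// ler0n.
  rewrite ler_pM2l// ge0_ler_powR// ?nnegrE ?(ltW dr0)//.
  by rewrite subr_ge0 invf_le1// ltW.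
Qed.

(** With [e = 128^-1] the factor [(2 e) ^ (1 / p)] is at most (1/64)^(1/2), uniformly in
    [p <= 2]. *)
Lemma powR_inv_le8 (p : R) : 0 < p -> p <= 2 -> (2 / 128) `^ p^-1 <= 8^-1 :> R.
Proof.
move=> p0 p2; have -> : 8^-1 = (2 / 128) `^ 2^-1 :> R.
  rewrite powR12_sqrt// (_ : 2 / 128 = 8^-1 ^+ 2); last by field.
  by rewrite sqrtr_sqr ger0_norm.
apply: ger_powR; first by apply/andP; split; lra.
by rewrite lef_pV2 ?posrE.
Qed.

(* Here v is a near-maximizer of the linear functional, so no upper bound on the
   dual norm of the noise is needed; the price |v|_2 <= 1 is harmless for k = 1. *)
Lemma mle_risk_ge_spike d p s t r :
  1 < p <= 2 -> 0 < s <= 1 -> 0 < t -> 0 <= r ->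
  r <= expR (- (t + 1) ^+ 2 / 2) / 3 -> 20 <= d.-1%:R * r ->
  208 < s * t * (d.-1%:R * r / 5) `^ (1 - p^-1) ->
  ((128^-1 ^+ 2 / 2)%:E <= mle_risk (@lp_ball R d p) s)%E.
Proof.
move=> /andP[p1 p2] /[dup] s01 /andP[s0 s1] t0 r0 rt dr cond.
have p0 : 0 < p by rewrite (lt_trans _ p1).
have d1 : (1 <= d)%N.
  by case: d dr {cond} => // /=; rewrite mul0r; lra.
have mg : measurable_fun [set: R] (fun=> 0 : R) by [].
rewrite -subn1 in dr cond.
have [|F [mF F0 IF HF]] := @good_event R d 1 (spike d 1 1) s (fun=> 0) 1 t r s0
  isT d1 ltr01 mg (fun _ => lexx _) _ (ltW t0) r0 rt dr.
  by move=> x; rewrite mul1r expR_ge0.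
apply: (@worst_risk_ge _ _ _ _ _ (spike d 1 1) F) => //.
- by apply: spike_lp_ball => //; rewrite powR1 mulr1.
move=> y /HF[wS nA _]; apply: ltW.
pose w i := tnth y i - tnth (spike d 1 1) i.
pose A : pred 'I_d := [pred i : 'I_d | (1 <= i)%N && (t * s <= `|w i|)].
have dr0 : 0 < (d - 1)%:R * r / 5 by lra.
have A0 : (0 < #|A|)%N by rewrite -(ltr0n R) (lt_le_trans dr0).
have Ac i : A i -> t * s <= `|w i| by move=> /andP[_].
have [v1 v2 v3] := flat_vectorP p0 A0 Ac.
set v := flat_vector A w p in v1 v2 v3.
(* The values of the noise functional on the ball off the spike; [sup X] serves as the exact bound
   [B]. *)
pose X := [set c : R | exists x : d.-tuple R,
  [/\ (forall i : 'I_d, (i < 1)%N -> tnth x i = 0),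
      \sum_(i < d) `|tnth x i| `^ p <= 1 & c = \sum_(i < d) w i * tnth x i]].
have coord (x : d.-tuple R) i : \sum_(i < d) `|tnth x i| `^ p <= 1 -> `|tnth x i| <= 1.
  move=> x1; rewrite leNgt; apply/negP => xi.
  have : 1 < `|tnth x i| `^ p by rewrite (lt_le_trans xi)// le1r_powR// ltW.
  move: x1; rewrite (bigD1 i)//=.
  have : 0 <= \sum_(j < d | j != i) `|tnth x j| `^ p.
    by apply: sumr_ge0 => j _; exact: powR_ge0.
  lra.
have Xv : X (\sum_(i < d) w i * tnth v i).
  by exists v; split => // i i1; rewrite tnth_mktuple /A /= leqNgt i1.
have supX : has_sup X.
  split; first by eexists; exact: Xv.
  exists (\sum_(i < d) `|w i|) => _ [x [_ x1 ->]].
  apply: ler_sum => i _; apply: (le_trans (ler_norm _)).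
  by rewrite normrM ler_piMr// coord.
(* The near-maximizer reaches more than [B / 2] and [projection_far] charges at most
   [B / 4 + 51 + 1]; hence 208 = 4 (51 + 1). *)
have Bbig : 208 < sup X.
  apply: (lt_le_trans cond); apply: le_trans (ub_le_sup supX.2 Xv).
  apply: le_trans v3; rewrite [s * t]mulrC ler_pM2l ?mulr_gt0//.
  rewrite ge0_ler_powR// ?nnegrE ?(ltW dr0)//.
  by rewrite subr_ge0 invf_le1// ltW.
have B0 : 0 < sup X / 2 by move: Bbig; clear; lra.
have [_ [x [x0 x1 ->]] xsup] := sup_adherent B0 supX.
have := @projection_far R d 1 p 1 s 128^-1 (sup X) y x.
rewrite expr1n !mulr1 powR1; apply => //.
- by rewrite (ltW p1).
- by rewrite invr_gt0 ltr0n/= invf_le1 ?ler1n// ltr0n.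
- by rewrite mulr1.
- by move: wS; rewrite mulr1.
- by move=> x' x'0 x'1; apply: (ub_le_sup supX.2); exists x'.
(* Coordinates are at most 1 in absolute value, so squares are below p-th powers. *)
have V1 : \sum_(i < d) tnth x i ^+ 2 <= 1.
  apply: (le_trans _ x1); apply: ler_sum => i _.
  have xi := coord x i x1.
  rewrite -real_normK ?num_real// -powR_mulrn//.
  have [->|xn0] := eqVneq `|tnth x i| 0.
    by rewrite !powR0// gt_eqF.
  apply: ger_powR => //; rewrite xi andbT lt_neqAle eq_sym xn0/=.
  exact: normr_ge0.
have : (2 / 128) `^ p^-1 * sup X <= 8^-1 * sup X.
  by rewrite ler_wpM2r ?powR_inv_le8// ltW//; move: Bbig; clear; lra.
rewrite -[X in _ < X]/(\sum_(i < d) w i * tnth x i).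
lra.
Qed.

End mle_lower.

(** * Soft thresholding and the minimax risk *)

Section minimax_upper.
Context {R : realType}.
Implicit Types (t x y s l : R).

(** Soft thresholding, written as [y] minus its truncation to the interval from [- t] to [t], which
    makes measurability immediate. *)
Definition soft t y : R := y - Num.max (- t) (Num.min t y).

Lemma measurable_soft t : measurable_fun [set: R] (soft t).
Proof.
apply: measurable_funB => //; apply: measurable_maxr => //.
exact: measurable_minr.
Qed.

Lemma softP t y : 0 <= t ->
  [\/ t < y /\ soft t y = y - t, y < - t /\ soft t y = y + t |
      (- t <= y /\ y <= t) /\ soft t y = 0].
Proof.
move=> t0; rewrite /soft; have [ty|ty] := ltP t y.
  by apply: Or31; split => //; rewrite max_r//; lra.
have [yt|yt] := ltP y (- t).
  by apply: Or32; split => //; rewrite opprK.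
by apply: Or33; split => //; rewrite subrr.
Qed.

Lemma soft_dist t y : 0 <= t -> `|soft t y - y| <= t.
Proof. by move=> t0; rewrite ler_norml; case: (softP y t0) => -[? ->]; lra. Qed.

Lemma soft_lipschitz t x y : 0 <= t -> `|soft t x - soft t y| <= `|x - y|.
Proof.
move=> t0; wlog xy : x y / x <= y.
  move=> H; have [xy|/ltW yx] := leP x y; first exact: H.
  by rewrite distrC [leRHS]distrC; exact: H.
rewrite [leRHS]distrC [leRHS]ger0_norm ?subr_ge0// ler_norml.
by case: (softP x t0) => -[? ->]; case: (softP y t0) => -[? ->]; lra.
Qed.

(** Where the left side is nonzero, [u = (x / s) ^ 2] is at least [l ^ 2]. Then [u <= 8 exp(u / 8)],
    and [u / 8 <= 3 u / 8 - l ^ 2 / 4]. *)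
Lemma soft_sqr_le s l x : 0 < s -> 0 <= l ->
  soft (s * l) x ^+ 2 <=
  8 * s ^+ 2 * expR (- (l ^+ 2) / 4) * expR (3 / 8 * (x / s) ^+ 2).
Proof.
move=> s0 l0; have sl : 0 <= s * l by rewrite mulr_ge0// ltW.
have [xl|xl] := leP `|x| (s * l).
  have -> : soft (s * l) x = 0.
    move: xl; rewrite ler_norml => /andP[h1 h2].
    by case: (softP x sl) => -[? ->]; lra.
  by rewrite expr0n/= !mulr_ge0 ?expR_ge0 ?exprn_ge0// ltW.
have sx : soft (s * l) x ^+ 2 <= x ^+ 2.
  rewrite -real_normK ?num_real// -[leRHS]real_normK ?num_real//.
  rewrite lerXn2r ?nnegrE//.
  have := @soft_lipschitz (s * l) x 0 sl.
  rewrite subr0; have -> : soft (s * l) 0 = 0.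
    by case: (softP 0 sl) => -[? ->]; lra.
  by rewrite subr0.
apply: (le_trans sx).
have lz : l ^+ 2 <= (x / s) ^+ 2.
  rewrite -[leRHS]real_normK ?num_real// lerXn2r ?nnegrE//.
  by rewrite normrM normfV (gtr0_norm s0) ler_pdivlMr// mulrC ltW.
rewrite -mulrA -expRD.
have -> : x ^+ 2 = s ^+ 2 * (x / s) ^+ 2 by rewrite -exprMn mulrC divfK// gt_eqF.
rewrite (_ : 8 * _ * _ = s ^+ 2 * (8 * expR (- l ^+ 2 / 4 + 3 / 8 * (x / s) ^+ 2))); last ring.
rewrite ler_pM2l ?exprn_gt0//.
set u := (x / s) ^+ 2 in lz *.
have := expR_ge1Dx (u / 8).
have : expR (u / 8) <= expR (- l ^+ 2 / 4 + 3 / 8 * u) by rewrite ler_expR; lra.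
lra.
Qed.

(** If [|theta| <= t], the estimator is compared with its value on pure noise, at a cost of order
    [theta ^ 2 <= t ^ (2 - p) |theta| ^ p]. If [|theta| > t], squared bias and variance are both of
    order at most [t ^ 2], below the same quantity. *)
Lemma soft_risk p theta s l : 1 <= p <= 2 -> 0 < s -> 1 <= l ->
  (\int[normal_law theta s]_x ((soft (s * l) x - theta) ^+ 2)%:E <=
   (16 * (s * l) `^ (2 - p) * `|theta| `^ p +
    32 * s ^+ 2 * expR (- (l ^+ 2) / 4))%:E)%E.
Proof.
move=> /andP[p1 p2] s0 l1; have p0 : 0 < p by rewrite (lt_le_trans _ p1).
have l0 : 0 <= l by rewrite (le_trans _ l1).
have sl0 : 0 < s * l by rewrite mulr_gt0// (lt_le_trans _ l1).
set t := s * l in sl0 *.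
have st : s <= t by rewrite /t ler_peMr// ltW.
have mg : measurable_fun [set: R] (fun x => (soft t x - theta) ^+ 2).
  by apply: measurable_funX; apply: measurable_funB => //; exact: measurable_soft.
have g0 x : 0 <= (soft t x - theta) ^+ 2 by exact: sqr_ge0.
have e1 x : 1 <= exp_moment theta s x.
  by rewrite -expR0 ler_expR mulr_ge0 ?sqr_ge0.
have tp : 0 < t `^ (2 - p) by rewrite powR_gt0.
have psplit x : 0 <= x -> x ^+ 2 = x `^ (2 - p) * x `^ p.
  by move=> x0; rewrite -powRD subrK ?powR_mulrn// pnatr_eq0.
have [tht|tht] := leP `|theta| t.
  have H x : (soft t x - theta) ^+ 2 <=
      (16 * s ^+ 2 * expR (- (l ^+ 2) / 4) + 8 * theta ^+ 2) * exp_moment theta s x.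
    have H1 := @soft_sqr_le s l (x - theta) s0 l0.
    rewrite -/t -/(exp_moment theta s x) in H1.
    have H2 := @soft_lipschitz t x (x - theta) (ltW sl0).
    have H3 : (soft t x - soft t (x - theta)) ^+ 2 <= theta ^+ 2.
      rewrite -real_normK ?num_real// -[leRHS]real_normK ?num_real//.
      rewrite lerXn2r ?nnegrE//; move: H2.
      by rewrite (_ : x - (x - theta) = theta)//; ring.
    have H4 : theta ^+ 2 <= theta ^+ 2 * exp_moment theta s x.
      by rewrite ler_peMr// sqr_ge0.
    move: H1 H3 H4; move: (exp_moment _ _ _) (expR _) (soft _ _) (soft _ _).
    move=> E F u v H1 H3 H4.
    have := sqr_ge0 (v - (u - v) + theta). have := sqr_ge0 (u - v + theta).
    nra.
  apply: (le_trans (normal_law_le_exp_moment s0 mg g0 H)).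
  rewrite lee_fin mulrDr addrC lerD//; last by lra.
  rewrite mulrA (_ : 2 * 8 = 16); last by ring.
  rewrite -mulrA ler_pM2l// -real_normK ?num_real// psplit//.
  by rewrite ler_wpM2r ?powR_ge0// ge0_ler_powR ?nnegrE ?subr_ge0 ?(ltW sl0).
have H x : (soft t x - theta) ^+ 2 <=
    (16 / 3 * s ^+ 2 + 2 * t ^+ 2) * exp_moment theta s x.
  have H1 := soft_dist x (ltW sl0).
  have H2 := sqr_le_exp_moment theta s x.
  have H3 : (soft t x - x) ^+ 2 <= t ^+ 2.
    by rewrite -real_normK ?num_real// lerXn2r ?nnegrE ?(ltW sl0).
  have H4 : (x - theta) ^+ 2 <= 8 / 3 * s ^+ 2 * exp_moment theta s x.
    have -> : (x - theta) ^+ 2 = s ^+ 2 * ((x - theta) / s) ^+ 2.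
      by rewrite -exprMn mulrC divfK// gt_eqF.
    rewrite (_ : 8 / 3 * _ * _ = s ^+ 2 * (8 / 3 * exp_moment theta s x)); last ring.
    by rewrite ler_pM2l// exprn_gt0.
  have H5 : t ^+ 2 <= t ^+ 2 * exp_moment theta s x.
    by rewrite ler_peMr// sqr_ge0.
  have := sqr_ge0 ((soft t x - x) - (x - theta)).
  lra.
apply: (le_trans (normal_law_le_exp_moment s0 mg g0 H)).
rewrite lee_fin; have st2 : s ^+ 2 <= t ^+ 2 by rewrite lerXn2r ?nnegrE ?(ltW s0) ?(ltW sl0).
have : t ^+ 2 <= t `^ (2 - p) * `|theta| `^ p.
  rewrite psplit ?(ltW sl0)// ler_pM2l// ge0_ler_powR ?nnegrE ?(ltW p0) ?(ltW sl0) ?(ltW tht)//.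
have : 0 <= 32 * s ^+ 2 * expR (- l ^+ 2 / 4) by rewrite mulr_ge0 ?expR_ge0// mulr_ge0 ?sqr_ge0.
have := sqr_ge0 t; lra.
Qed.

Lemma minimax_risk_le d p s l : 1 <= p <= 2 -> 0 < s -> 1 <= l ->
  (minimax_risk (@lp_ball R d p) s <=
   (16 * (s * l) `^ (2 - p) + 32 * d%:R * s ^+ 2 * expR (- (l ^+ 2) / 4))%:E)%E.
Proof.
move=> p12 s0 l1; have p0 : 0 < p by case/andP: p12 => p1 _; rewrite (lt_le_trans _ p1).
pose est (y : d.-tuple R) : d.-tuple R := [tuple soft (s * l) (tnth y i) | i < d].
have mest : measurable_fun [set: d.-tuple R] est.
  apply/measurable_fun_tnthP => i.
  rewrite (_ : _ \o _ = fun y : d.-tuple R => soft (s * l) (tnth y i)).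
    exact: (measurableT_comp (@measurable_soft _) (measurable_tnth i)).
  by apply/funext => y /=; rewrite tnth_mktuple.
apply: (@le_trans _ _ (worst_risk (@lp_ball R d p) s est)).
  by apply: ereal_inf_lbound; exists est.
apply: ge_ereal_sup => _ [theta thB <-].
rewrite unlock /sqdist.
under eq_integral do under eq_bigr do rewrite tnth_mktuple.
rewrite (@integral_sum_tnth R d theta s predT
  (fun i x => (soft (s * l) x - tnth theta i) ^+ 2)); last 2 first.
- move=> i; apply: measurable_funX; apply: measurable_funB => //; exact: measurable_soft.
- by move=> i x; exact: sqr_ge0.
apply: le_trans (lee_sum _ (fun i _ => soft_risk (tnth theta i) p12 s0 l1)) _.
rewrite sumEFin lee_fin big_split/= -mulr_sumr sumr_const card_ord.
rewrite lerD//.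
  rewrite -[leRHS]mulr1 ler_wpM2l ?mulr_ge0 ?powR_ge0//.
  exact/lp_ballE.
rewrite -[_ *+ d]mulr_natl; lra.
Qed.

End minimax_upper.

(** * Minimax bounds at the two threshold levels, and the step to the ratio *)

Section ratio.
Context {R : realType}.

Lemma minimax_risk_ge0 d p s : 0 < p -> (0 <= minimax_risk (@lp_ball R d p) s)%E.
Proof.
move=> p0; apply: le_ereal_inf_tmp => _ [est _ <-].
pose z : d.-tuple R := [tuple 0 | i < d].
apply: (@le_trans _ _ 'E_(gaussian z s)[(fun Y => sqdist (est Y) z)]%E).
  rewrite unlock; apply: integral_ge0 => y _.
  by rewrite lee_fin; apply: sumr_ge0 => i _; exact: sqr_ge0.
apply: ereal_sup_ubound; exists z => //.
apply/lp_ballE => //; rewrite big1 ?ler01// => i _.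
by rewrite tnth_mktuple normr0 powR0// gt_eqF.
Qed.

Lemma ratio_ge (x y : \bar R) (a b c : R) :
  0 < a -> 0 <= c -> (a%:E <= x)%E -> (0 <= y)%E -> (y <= b%:E)%E ->
  c * b <= a -> (c%:E <= x / y)%E.
Proof.
move=> a0 c0 ax y0 yb cba.
case: y y0 yb => [y| |] //; rewrite !lee_fin => y0 yb.
(* A zero denominator has inverse [+oo], and the numerator is positive, so the ratio is then
   infinite. *)
rewrite inver; case: eqVneq => [yE|yn0].
  rewrite gt0_muley ?leey//.
  by rewrite (lt_le_trans _ ax)// lte_fin.
have yp : 0 < y by rewrite lt_neqAle eq_sym yn0.
apply: (@le_trans _ _ (a%:E * y^-1%:E)%E).
  rewrite -EFinM lee_fin ler_pdivlMr//; apply: le_trans cba.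
  by rewrite ler_wpM2l.
by apply: lee_wpmul2r => //; rewrite lee_fin invr_ge0.
Qed.

Lemma powRN_small (g c e : R) : 0 < g -> 0 <= c -> 0 < e ->
  exists2 x0 : R, 0 < x0 & forall x : R, x0 <= x -> c * x `^ (- g) <= e.
Proof.
move=> g0 c0 e0; have ce : 0 <= c / e by rewrite divr_ge0// ltW.
exists ((c / e) `^ g^-1 + 1); first by rewrite ltr_wpDl ?powR_ge0.
move=> x xx0; have xp : 0 < x.
  by rewrite (lt_le_trans _ xx0)// ltr_wpDl ?powR_ge0.
rewrite powRN ler_pdivrMr ?powR_gt0// -ler_pdivrMl// mulrC.
have -> : c / e = ((c / e) `^ g^-1) `^ g.
  by rewrite -powRrM mulVf ?gt_eqF// powRr1.
rewrite ge0_ler_powR ?(ltW g0)// ?nnegrE ?powR_ge0 ?(ltW xp)//.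
by rewrite (le_trans _ xx0)// lerDl.
Qed.

(** The level [l ^ 2 = 4 ln d] turns [expR (- l ^ 2 / 4)] into [1 / d]. The gap [h] below 2 makes
    the remaining exponent uniform in [p]. *)
Lemma minimax_risk_le_ln d p s h : 1 <= p -> p <= 2 - 2 * h -> 0 < h -> 0 < s ->
  1 <= ln d%:R :> R -> 4 * (s ^+ 2 * ln d%:R) <= 1 ->
  (minimax_risk (@lp_ball R d p) s <=
    (24 * (4 * (s ^+ 2 * ln d%:R)) `^ h)%:E)%E.
Proof.
move=> p1 ph h0 s0 lnd u1; set u := s ^+ 2 * ln d%:R in u1 *.
have d0 : 0 < d%:R :> R.
  by rewrite ltNge; apply/negP => /ln0 ln0; move: lnd; rewrite ln0; lra.
have u0 : 0 < u by rewrite mulr_gt0 ?exprn_gt0//; lra.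
pose l := Num.sqrt (4 * ln d%:R) : R.
have l2 : l ^+ 2 = 4 * ln d%:R by rewrite sqr_sqrtr//; lra.
have l0 : 0 <= l by exact: sqrtr_ge0.
have l1 : 1 <= l.
  by rewrite -(@ler_pXn2r _ 2)// ?nnegrE// expr1n l2; lra.
have p12 : 1 <= p <= 2 by apply/andP; split; lra.
apply: (le_trans (minimax_risk_le d p12 s0 l1)).
rewrite lee_fin l2.
have -> : - (4 * ln d%:R) / 4 = - ln d%:R :> R by field.
rewrite expRN lnK ?posrE//.
have -> : 32 * d%:R * s ^+ 2 / d%:R = 32 * s ^+ 2 by field; rewrite gt_eqF.
have -> : (s * l) `^ (2 - p) = (4 * u) `^ ((2 - p) / 2).
  have -> : 4 * u = (s * l) ^+ 2 by rewrite exprMn l2 /u; ring.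
  by rewrite -powR_mulrn ?mulr_ge0 ?(ltW s0)// -powRrM; congr (_ `^ _); field.
have u4 : 0 < 4 * u <= 1 by rewrite u1 andbT mulr_gt0.
have H1 : (4 * u) `^ ((2 - p) / 2) <= (4 * u) `^ h.
  by apply: ger_powR => //; lra.
have H2 : 4 * u <= (4 * u) `^ h by apply: ger1_powR => //; lra.
have H3 : s ^+ 2 <= u by rewrite /u ler_peMr// sqr_ge0.
lra.
Qed.

Lemma minimax_risk_small h e : 0 < h -> 0 < e ->
  exists2 u0 : R, 0 < u0 & forall d p s, 1 <= p -> p <= 2 - 2 * h -> 0 < s ->
    1 <= ln d%:R :> R -> s ^+ 2 * ln d%:R <= u0 ->
    (minimax_risk (@lp_ball R d p) s <= e%:E)%E.
Proof.
move=> h0 e0; have e24 : 0 < e / 24 by rewrite divr_gt0.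
have eh : 0 < (e / 24) `^ h^-1 by rewrite powR_gt0.
exists (Num.min 1 ((e / 24) `^ h^-1) / 4).
  by rewrite divr_gt0// lt_min ltr01.
move=> d p s p1 ph s0 lnd; rewrite ler_pdivlMr// mulrC le_min => /andP[u1 u2].
apply: (le_trans (minimax_risk_le_ln p1 ph h0 s0 lnd u1)).
rewrite lee_fin -ler_pdivlMl//.
have -> : 24^-1 * e = ((e / 24) `^ h^-1) `^ h.
  by rewrite -powRrM mulVf ?gt_eqF// powRr1 ?(ltW e24)// mulrC.
rewrite ge0_ler_powR ?(ltW h0)// ?nnegrE ?powR_ge0//.
by rewrite !mulr_ge0 ?sqr_ge0//; lra.
Qed.

(** The level [l ^ 2 = 4 ln x] makes both terms at most a multiple of [s ^ (2 - p) ln x]. The last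
    factor is the gain over [s d ^ (1 / q)] that makes the ratio diverge. *)
Lemma minimax_risk_le_powR d p s (q := p / (p - 1)) (x := s `^ p * d%:R) :
  1 < p < 2 -> 0 < s -> expR 1 <= x ->
  (minimax_risk (@lp_ball R d p) s <=
    (192 * q * (s * d%:R `^ q^-1) * x `^ - (2 * q)^-1)%:E)%E.
Proof.
move=> /andP[p1 p2] s0 xe.
have e0 := expR_gt0 (1 : R).
have x0 : 0 < x by exact: lt_le_trans xe.
have sp0 : 0 < s `^ p by rewrite powR_gt0.
have d0 : 0 < d%:R :> R by move: x0; rewrite /x pmulr_rgt0.
have pm : 0 < p - 1 by lra.
have p0 : 0 < p by lra.
have q0 : 0 < q by rewrite divr_gt0.
have lnx : 1 <= ln x by rewrite -(expRK 1) ler_ln ?posrE.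
pose l := Num.sqrt (4 * ln x) : R.
have l2 : l ^+ 2 = 4 * ln x by rewrite sqr_sqrtr//; lra.
have l0 : 0 <= l by exact: sqrtr_ge0.
have l1 : 1 <= l.
  by rewrite -(@ler_pXn2r _ 2)// ?nnegrE// expr1n l2; lra.
have p12 : 1 <= p <= 2 by apply/andP; split; lra.
apply: (le_trans (minimax_risk_le d p12 s0 l1)).
rewrite lee_fin l2.
have -> : - (4 * ln x) / 4 = - ln x by field.
rewrite expRN lnK ?posrE//.
have s2p : 0 < s `^ (2 - p) by rewrite powR_gt0.
have ds : 32 * d%:R * s ^+ 2 / x = 32 * s `^ (2 - p).
  rewrite /x -powR_mulrn ?(ltW s0)// -{1}(subrK p 2) powRD.
    by field; rewrite !gt_eqF.
  by rewrite (gt_eqF s0) implybT.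
rewrite ds powRM ?(ltW s0)//.
have ll : l `^ (2 - p) <= 4 * ln x.
  rewrite -l2 -powR_mulrn//; apply: ler_powR => //; lra.
(* The logarithm is estimated at the root [x ^ (1 / (2 q))], spending only half of the available
   power [x ^ (1 / q)]. *)
have lnle : ln x <= 2 * q * x `^ (2 * q)^-1.
  have := ln_sublinear (powR_gt0 (2 * q)^-1 x0).
  by rewrite ln_powR => /ltW; rewrite ler_pdivrMl// mulr_gt0.
have -> : s * d%:R `^ q^-1 = s `^ (2 - p) * (x `^ (2 * q)^-1 * x `^ (2 * q)^-1).
  apply: ln_inj; rewrite ?posrE ?mulr_gt0 ?powR_gt0//.
  rewrite !lnM ?posrE ?mulr_gt0 ?powR_gt0// !ln_powR lnM ?posrE// ln_powR /q.
  by field; rewrite !gt_eqF.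
rewrite powRN.
have xq : 0 < x `^ (2 * q)^-1 by rewrite powR_gt0.
set y := x `^ _ in lnle xq *.
have -> : 192 * q * (s `^ (2 - p) * (y * y)) / y = s `^ (2 - p) * (192 * q * y).
  by field; rewrite gt_eqF.
have : s `^ (2 - p) * l `^ (2 - p) <= s `^ (2 - p) * (4 * ln x).
  by rewrite ler_pM2l.
have : s `^ (2 - p) * (96 * ln x) <= s `^ (2 - p) * (192 * q * y).
  rewrite ler_pM2l//; lra.
have : s `^ (2 - p) <= s `^ (2 - p) * ln x by rewrite ler_peMr// ltW.
lra.
Qed.

End ratio.

(** * Choice of the parameters *)

Section regimes.
Context {R : realType}.

(* k is about x^(- p / (2 - p)), which makes k a^2 = k^(1 - 2 / p) of order
   min 1 x. *)
Lemma spike_count (p x : R) : 1 <= p < 2 -> 0 < x ->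
  exists k (a : R), [/\ (0 < k)%N, 0 < a & k%:R * a `^ p = 1] /\
    [/\ a = k%:R `^ (- p^-1), Num.min 1 x / 2 <= k%:R * a ^+ 2, k%:R * a ^+ 2 <= x &
      k%:R <= 1 + x `^ (- (p / (2 - p)))].
Proof.
move=> /andP[p1 p2] x0; have p0 : 0 < p by rewrite (lt_le_trans _ p1).
set y := x `^ (- (p / (2 - p))).
have y0 : 0 < y by rewrite powR_gt0.
pose k := (Num.truncn y).+1.
have k0 : 0 < k%:R :> R by rewrite ltr0n.
have /andP[k1 k2] := truncn_itv (ltW y0); rewrite -/k in k2.
have {}k1 : k%:R <= 1 + y by rewrite /k -natr1; lra.
pose a : R := k%:R `^ (- p^-1).
have a0 : 0 < a by rewrite powR_gt0.
have p2p : 0 < (2 - p) / p by rewrite divr_gt0//; lra.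
have ka2 : k%:R * a ^+ 2 = k%:R `^ (- ((2 - p) / p)).
  apply: ln_inj; rewrite ?posrE ?mulr_gt0 ?exprn_gt0 ?powR_gt0//.
  rewrite lnM ?posrE ?exprn_gt0 ?powR_gt0// lnXn// !ln_powR -mulr_natl.
  by field; rewrite gt_eqF.
have yx : y `^ (- ((2 - p) / p)) = x.
  rewrite /y -powRrM (_ : _ * _ = 1) ?powRr1 ?(ltW x0)//.
  by field; apply/andP; split; rewrite gt_eqF//; lra.
have mono (u v : R) : 0 < u -> u <= v ->
    v `^ (- ((2 - p) / p)) <= u `^ (- ((2 - p) / p)).
  move=> u0 uv; have v0 : 0 < v by exact: lt_le_trans uv.
  rewrite !powRN lef_pV2 ?posrE ?powR_gt0//.
  by rewrite ge0_ler_powR ?nnegrE ?(ltW p2p) ?(ltW u0) ?(ltW v0).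
(* Rounding gives [k <= 2 max 1 y], and since [(2 - p) / p <= 1] this costs at most a factor 2. *)
have half : 2^-1 <= 2 `^ (- ((2 - p) / p)) :> R.
  rewrite powRN lef_pV2 ?posrE ?powR_gt0// -[leRHS]powRr1//.
  apply: ler_powR; first by rewrite ler1n.
  by rewrite ler_pdivrMr//; lra.
exists k, a; split; split => //.
- rewrite /a -powRrM mulNr mulVf ?gt_eqF// powR_inv1 ?(ltW k0)// divff// gt_eqF//.
- rewrite ka2; have [x1|x1] := leP 1 x.
    have y1 : y <= 1.
      have z0 : 0 <= p / (2 - p) by rewrite divr_ge0 ?subr_ge0 ?(ltW p0) ?(ltW p2).
      by rewrite /y powRN invf_le1 ?powR_gt0//; have := ler_powR x1 z0; rewrite powRr0.
    rewrite mul1r (le_trans half)//; apply: mono => //; lra.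
  have y1 : 1 <= y.
    rewrite leNgt; apply/negP => y1.
    have : 1 `^ (- ((2 - p) / p)) <= y `^ (- ((2 - p) / p)) by apply: mono => //; lra.
    by rewrite yx powR1 leNgt x1.
  apply: (@le_trans _ _ ((2 * y) `^ (- ((2 - p) / p)))); last by apply: mono => //; lra.
  by rewrite powRM ?(ltW y0)// yx mulrC ler_pM2r.
- by rewrite ka2 -[leRHS]yx; apply: mono => //; exact: ltW.
Qed.

(** * Power identities, checked on logarithms, that express the constraints on [k] through
    [s ^ p * y] *)

Section scaling.
Variables p s y c : R.
Hypotheses (p1 : 1 < p) (p2 : p < 2) (s0 : 0 < s) (y0 : 0 < y) (c0 : 0 < c).

Let p0 : 0 < p. Proof. exact: lt_trans p1. Qed.
Let pn0 : p != 0. Proof. by rewrite gt_eqF. Qed.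
Let p2n0 : 2 - p != 0. Proof. by rewrite gt_eqF// subr_gt0. Qed.
Let pos := (posrE, mulr_gt0, powR_gt0).

(** Used with [y = d] to make [k / d] small. *)
Lemma scale_powR_d : (c * (s * y `^ (1 - p^-1))) `^ (- (p / (2 - p))) =
  c `^ (- (p / (2 - p))) * (s `^ p * y) `^ (- (2 - p)^-1) * y.
Proof.
apply: ln_inj; rewrite ?pos//.
rewrite !(ln_powR, lnM) ?pos//.
by field; rewrite pn0 p2n0.
Qed.

(** Used to make [k s ^ p] small, which gives [s <= a]. *)
Lemma scale_powR_s : (c * (s * y `^ (1 - p^-1))) `^ (- (p / (2 - p))) * s `^ p =
  c `^ (- (p / (2 - p))) * (s `^ p * y) `^ (- ((p - 1) / (2 - p))).
Proof.
apply: ln_inj; rewrite ?pos//.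
rewrite !(ln_powR, lnM) ?pos//.
by field; rewrite pn0 p2n0.
Qed.

(** Used to make the squared length of the flat direction small against [s * y ^ (1 - 1 / p)]. *)
Lemma scale_powR_V :
  (s `^ p * y) `^ (- p^-1) * (s * y `^ (1 - p^-1)) = y `^ (1 - 2 / p).
Proof.
apply: ln_inj; rewrite ?pos//.
rewrite !(ln_powR, lnM) ?pos//.
by field; rewrite pn0.
Qed.

End scaling.

(** With [Y = s d ^ (1 / q)], the gain in [mle_risk_ge_flat] is [c2 * Y]. The constants [e], [kp]
    and [x1] each keep one of the three costs below a quarter of it. *)
Lemma mle_risk_ge_min (p : R) (q := p / (p - 1)) : 1 < p < 2 ->
  exists c x0 d0 : R, [/\ 0 < c, 0 < x0 & forall d (s : R), 0 < s -> s `^ p <= 2^-1 ->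
    x0 <= s `^ p * d%:R -> d0 <= d%:R ->
    ((c * Num.min 1 (s * d%:R `^ q^-1))%:E <= mle_risk (@lp_ball R d p) s)%E].
Proof.
move=> /[dup] p12 /andP[p1 p2].
have p0 : 0 < p by lra.
have pm : 0 < p - 1 by lra.
have p2m : 0 < 2 - p by lra.
have q0 : 0 < q by rewrite divr_gt0.
have qV : q^-1 = 1 - p^-1 by rewrite /q; field; rewrite !gt_eqF.
have pq : p^-1 + q^-1 = 1 by rewrite qV; ring.
have [K K0 HK] := @powR_le_expR_sqr R q (ltW q0).
pose r : R := expR (- 2) / 3.
have r0 : 0 < r by rewrite divr_gt0 ?expR_gt0.
pose C := (12 * K) `^ q^-1.
have C0 : 0 < C by rewrite powR_gt0// mulr_gt0.
pose c2 := (r / 10) `^ q^-1.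
have c20 : 0 < c2 by rewrite powR_gt0// divr_gt0.
pose m := c2 / (8 * C).
have m0 : 0 < m by rewrite divr_gt0 ?mulr_gt0.
pose e := Num.min 1 (m `^ p / 2).
have e0 : 0 < e by rewrite lt_min ltr01 divr_gt0 ?powR_gt0.
have e1 : e <= 1 by rewrite ge_min lexx.
have em : (2 * e) `^ p^-1 <= m.
  have -> : m = (m `^ p) `^ p^-1 by rewrite -powRrM divff ?gt_eqF// powRr1 ?ltW.
  rewrite ge0_ler_powR ?nnegrE ?invr_ge0 ?(ltW p0) ?powR_ge0 ?mulr_ge0 ?(ltW e0)//.
  by rewrite mulrC -ler_pdivlMr// ge_min lexx orbT.
(* 204 = 4 * 51, so a spike with squared norm at most [kp * Y] costs at most [c2 / 4 * Y]. *)
pose kp := c2 / 204.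
have kp0 : 0 < kp := divr_gt0 c20 (ltr0Sn R 203).
pose c3 := (r / 10) `^ (1 - 2 / p).
have c30 : 0 < c3 by rewrite powR_gt0// divr_gt0.
have c24 : 0 < c2 / 4 by rewrite divr_gt0.
pose kps := kp `^ (- (p / (2 - p))).
have kps0 : 0 < kps by rewrite powR_gt0.
have pV : 0 < p^-1 by rewrite invr_gt0.
(* [x1] controls the length of [v], [x2] ensures [2 k <= d], and [x3] ensures [s <= a]. *)
have [x1 x10 X1] := powRN_small pV (ltW c30) c24.
have g2 : 0 < (2 - p)^-1 by rewrite invr_gt0.
have q4 : 0 < 4^-1 :> R by [].
have [x2 x20 X2] := powRN_small g2 (ltW kps0) q4.
have g3 : 0 < (p - 1) / (2 - p) by rewrite divr_gt0.
have h2 : 0 < 2^-1 :> R by [].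
have [x3 x30 X3] := powRN_small g3 (ltW kps0) h2.
(* In the bound on [d], 4 absorbs the rounding in [k <= 1 + d / 4], and [40 / r] gives
   [d * r >= 40]. *)
exists (e ^+ 2 * Num.min 1 kp / 4), (x1 + x2 + x3), (4 + 40 / r).
split; first by rewrite !mulr_gt0 ?exprn_gt0// lt_min ltr01.
  by rewrite !addr_gt0.
move=> d s s0 sp xx dd.
set x := s `^ p * d%:R in xx.
have x0 : 0 < x by rewrite (lt_le_trans _ xx)// !addr_gt0.
have {}X1 : c3 * x `^ (- p^-1) <= c2 / 4 by apply: X1; move: xx x20 x30; clear; lra.
have {}X2 : kps * x `^ (- (2 - p)^-1) <= 4^-1 by apply: X2; move: xx x10 x30; clear; lra.
have {}X3 : kps * x `^ (- ((p - 1) / (2 - p))) <= 2^-1 by apply: X3; move: xx x10 x20; clear; lra.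
have sp0 : 0 < s `^ p by rewrite powR_gt0.
have d0 : 0 < d%:R :> R by move: x0; rewrite /x pmulr_rgt0.
have r40 : 0 < 40 / r by rewrite divr_gt0.
pose Y := s * d%:R `^ q^-1; rewrite -/Y.
have Y0 : 0 < Y by rewrite mulr_gt0 ?powR_gt0.
pose X := kp * Y; have XX0 : 0 < X by rewrite mulr_gt0.
have p12' : 1 <= p < 2 by rewrite ltW.
have [k [a [[k0 a0 ka] [aE Tge Tle kle]]]] := spike_count p12' XX0.
have kR : 0 < k%:R :> R by rewrite ltr0n.
have XsE : X `^ (- (p / (2 - p))) = kps * x `^ (- (2 - p)^-1) * d%:R.
  by rewrite /X /Y qV scale_powR_d.
have XsE' : X `^ (- (p / (2 - p))) * s `^ p = kps * x `^ (- ((p - 1) / (2 - p))).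
  by rewrite /X /Y qV scale_powR_s.
have kd : (k.*2 <= d)%N.
  rewrite -(ler_nat R) -mul2n natrM.
  have : X `^ (- (p / (2 - p))) <= 4^-1 * d%:R by rewrite XsE ler_pM2r.
  by move: kle dd r40; clear; lra.
(* Equivalent to [s ^ p * k <= 1], where [s ^ p] and [s ^ p * X ^ (- p / (2 - p))] contribute at
   most 1/2 each. *)
have sa : s <= a.
  have -> : s = (s `^ p) `^ p^-1 by rewrite -powRrM divff ?gt_eqF// powRr1 ?ltW.
  have -> : a = k%:R^-1 `^ p^-1 by rewrite aE -(powR_inv1 (ltW kR)) -powRrM mulN1r.
  rewrite ge0_ler_powR ?nnegrE ?(ltW pV) ?powR_ge0 ?invr_ge0 ?(ltW kR)//.
  rewrite -[leRHS]mul1r ler_pdivlMr//.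
  have : s `^ p * k%:R <= s `^ p * (1 + X `^ (- (p / (2 - p)))) by rewrite ler_pM2l.
  rewrite mulrDr mulr1 [s `^ p * X `^ _]mulrC XsE'.
  by move: X3 sp; clear; lra.
have cond : 2 * (2 * e) `^ p^-1 * (s * (12 * K * d%:R) `^ q^-1) + 51 * (k%:R * a ^+ 2)
    + (d%:R * r / 10) `^ (1 - 2 / p) < s * (d%:R * r / 10) `^ (1 - p^-1).
  have -> : s * (12 * K * d%:R) `^ q^-1 = C * Y.
    by rewrite powRM ?mulr_ge0 ?(ltW K0) ?(ltW d0)// /C /Y; ring.
  have -> : s * (d%:R * r / 10) `^ (1 - p^-1) = c2 * Y.
    rewrite -qV -mulrA powRM ?divr_ge0 ?(ltW d0) ?(ltW r0)// /c2 /Y; ring.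
  have -> : (d%:R * r / 10) `^ (1 - 2 / p) = c3 * x `^ (- p^-1) * Y.
    rewrite -mulrA powRM ?divr_ge0 ?(ltW d0) ?(ltW r0)// mulrC -mulrA.
    by rewrite /Y qV -(scale_powR_V p1 s0 d0).
  have : 2 * (2 * e) `^ p^-1 * (C * Y) <= c2 / 4 * Y.
    have -> : c2 / 4 * Y = 2 * m * (C * Y).
      by rewrite /m; field; rewrite gt_eqF.
    by rewrite (ler_pM2r (mulr_gt0 C0 Y0)) -[leRHS]/(2 * m) (ler_pM2l (ltr0n _ 2)).
  have : c3 * x `^ (- p^-1) * Y <= c2 / 4 * Y by rewrite ler_pM2r.
  have : 51 * (k%:R * a ^+ 2) <= c2 / 4 * Y.
    have -> : c2 / 4 * Y = 51 * X by rewrite /X /kp; field.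
    by rewrite ler_pM2l.
  have : 0 < c2 * Y by rewrite mulr_gt0.
  by clear; lra.
have r40d : 40 <= d%:R * r by rewrite -ler_pdivrMr//; move: dd; clear; lra.
have := @mle_risk_ge_flat R d k p q K a s e.
rewrite -/r => /(_ _ _ _ _ HK a0 _ _ k0 kd ka r40d cond) H.
apply: le_trans (H _ _ _ _ _ _) => //; last 3 first.
- by rewrite p1 ltW.
- by rewrite s0.
- by rewrite e0.
have kmin : Num.min 1 kp * Num.min 1 Y <= Num.min 1 X.
  have mk0 : 0 <= Num.min 1 kp by rewrite le_min ler01 ltW.
  have mY0 : 0 <= Num.min 1 Y by rewrite le_min ler01 ltW.
  rewrite le_min; apply/andP; split.
    by rewrite mulr_ile1// ge_min lexx.
  by rewrite /X ler_pM// ge_min lexx orbT.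
rewrite lee_fin (_ : _ / 4 * _ = e ^+ 2 * (Num.min 1 kp * Num.min 1 Y / 4)); last ring.
rewrite -[leRHS]mulrA (ler_pM2l (exprn_gt0 2 e0)).
by move: kmin Tge; clear; lra.
Qed.

Lemma ratio_fixed_p (p A : R) : 1 < p < 2 -> 0 <= A ->
  exists x0 d0 u0 : R, 0 < u0 /\ forall d (s : R), 0 < s ->
    x0 <= s `^ p * d%:R -> d0 <= d%:R -> 1 <= ln d%:R :> R -> s ^+ 2 * ln d%:R <= u0 ->
    (A%:E <= mle_competitive_ratio (@lp_ball R d p) s)%E.
Proof.
move=> /[dup] p12 /andP[p1 p2] A0.
have [c [x0 [d0 [c0 x00 mle]]]] := mle_risk_ge_min p12.
pose q := p / (p - 1); rewrite -/q in mle.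
have pm : 0 < p - 1 by rewrite subr_gt0.
have q0 : 0 < q by rewrite divr_gt0//; lra.
have A1 : 0 < A + 1 by rewrite ltr_wpDl.
have cA : 0 < c / (A + 1) by rewrite divr_gt0.
have h0 : 0 < (2 - p) / 2 by rewrite divr_gt0//; lra.
have [u1 u10 mm1] := minimax_risk_small h0 cA.
have g0 : 0 < (2 * q)^-1 by rewrite invr_gt0 mulr_gt0.
have q192 : 0 <= 192 * q := mulr_ge0 (ler0n R 192) (ltW q0).
have [x1 x10 mm2] := powRN_small g0 q192 cA.
(* The bound 1/4 on the noise forces [s <= 1 / 2], hence [s ^ p <= 1 / 2] as [mle_risk_ge_min]
   demands. *)
exists (x0 + x1 + expR 1), d0, (Num.min u1 4^-1); split.
  by rewrite lt_min u10 invr_gt0 ltr0n.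
move=> d s s0 xx dd lnd; rewrite le_min => /andP[uu1 uu4].
have e0 := expR_gt0 (1 : R).
have p0 : 0 < p by lra.
have s2 : s ^+ 2 <= 2^-1 ^+ 2.
  apply: (@le_trans _ _ (s ^+ 2 * ln d%:R)); last by rewrite (le_trans uu4)//; lra.
  by rewrite ler_peMr// sqr_ge0.
have s12 : s <= 2^-1 by move: s2; rewrite ler_pXn2r ?nnegrE ?(ltW s0).
have sp : s `^ p <= 2^-1.
  by rewrite (le_trans _ s12)// ge1r_powR ?s0 ?(ltW p1)//=; lra.
have M1 : (minimax_risk (@lp_ball R d p) s <= (c / (A + 1))%:E)%E.
  by apply: mm1 => //; move: p1; clear; lra.
have xe : expR 1 <= s `^ p * d%:R by move: xx x00 x10; clear; lra.
have M2 := minimax_risk_le_powR p12 s0 xe.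
have {mle}L : ((c * Num.min 1 (s * d%:R `^ q^-1))%:E <= mle_risk (@lp_ball R d p) s)%E.
  by apply: mle => //; move: xx x10 e0; clear; lra.
have x0' : 0 < s `^ p * d%:R by rewrite (lt_le_trans e0).
have d0' : 0 < d%:R :> R by move: x0'; rewrite pmulr_rgt0// powR_gt0.
have Y0 : 0 < s * d%:R `^ q^-1 by rewrite mulr_gt0// powR_gt0.
rewrite -/q in M2.
set Y := s * _ in Y0 L M2.
have {}M2 : (minimax_risk (@lp_ball R d p) s <= (c / (A + 1) * Y)%:E)%E.
  apply: (le_trans M2); rewrite lee_fin mulrAC ler_pM2r//.
  by apply: mm2; move: xx x00 e0; clear; lra.
(* Each minimax bound matches one branch of the minimum in the lower bound [L]. *)
have {M1 M2}M : (minimax_risk (@lp_ball R d p) s <= (c / (A + 1) * Num.min 1 Y)%:E)%E.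
  by case: (leP 1 Y); rewrite ?mulr1.
apply: (ratio_ge _ A0 L (minimax_risk_ge0 d s p0) M).
  by rewrite mulr_gt0// lt_min ltr01.
rewrite mulrA ler_pM2r ?lt_min ?ltr01//.
by rewrite mulrA ler_pdivrMr// mulrC ler_pM2l// lerDl.
Qed.

(** The hypothesis of case (ii), taken to the power [1 / p] in logarithms. The square on [b] is
    enough because [p <= 2] and [b >= 1]. *)
Lemma width_lower (p s y b : R) : 1 < p <= 2 -> 0 < s -> 0 < y -> 1 <= b ->
  b ^+ 2 * (y `^ (2 - p) * (1 - 1 / p) `^ (p / 2)) <= s `^ p * y ->
  b <= s * Num.sqrt (p / (p - 1)) * y `^ (1 - p^-1).
Proof.
move=> /andP[p1 p2] s0 y0 b1.
have p0 : 0 < p by rewrite (lt_trans _ p1).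
have pm : 0 < p - 1 by rewrite subr_gt0.
have b0 : 0 < b by rewrite (lt_le_trans _ b1).
have pq : 0 < p / (p - 1) by rewrite divr_gt0.
have -> : 1 - 1 / p = (p / (p - 1))^-1 by field; rewrite !gt_eqF.
rewrite -powR12_sqrt ?(ltW pq)//.
have qV : p^-1 = 1 - (p / (p - 1))^-1 by field; rewrite !gt_eqF.
move: (p / (p - 1)) pq qV => q q0 qV.
have pos := (posrE, mulr_gt0, powR_gt0, exprn_gt0, invr_gt0).
rewrite -ler_ln ?pos// => H.
have {}H : 2 * ln b + ((2 - p) * ln y + p / 2 * - ln q) <= p * ln s + ln y.
  move: H; rewrite !(ln_powR, lnM, lnXn, lnV) ?pos//.
  by rewrite -[ln b *+ 2]mulr_natl.
rewrite -ler_ln ?pos// !(ln_powR, lnM) ?pos//.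
have lb : 0 <= ln b by exact: ln_ge0.
rewrite -(ler_pM2l p0).
have -> : p * (ln s + 2^-1 * ln q + (1 - p^-1) * ln y) =
    p * ln s + p / 2 * ln q + (p - 1) * ln y.
  by field; rewrite gt_eqF.
have : p * ln b <= 2 * ln b by rewrite ler_wpM2r.
move: H; clear; lra.
Qed.

Lemma ratio_varying_p (h A : R) : 0 < h -> 0 <= A ->
  exists b d0 u0 : R, 0 < u0 /\ forall d (p s : R), 1 < p -> p <= 2 - 2 * h -> 0 < s ->
    24 <= (p - 1) * (1 + ln d%:R) ->
    b * (d%:R `^ (2 - p) * (1 - 1 / p) `^ (p / 2)) <= s `^ p * d%:R ->
    d0 <= d%:R -> 1 <= ln d%:R :> R -> s ^+ 2 * ln d%:R <= u0 ->
    (A%:E <= mle_competitive_ratio (@lp_ball R d p) s)%E.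
Proof.
move=> h0 A0.
have A1 : 0 < A + 1 by rewrite ltr_wpDl.
pose c : R := 128^-1 ^+ 2 / 2.
have c0 : 0 < c by rewrite divr_gt0// exprn_gt0// invr_gt0.
have cA : 0 < c / (A + 1) by rewrite divr_gt0.
have [u1 u10 mm1] := minimax_risk_small h0 cA.
(* Later [b0] is multiplied by [expR (- 3) / 10], which leaves 208.1, just above the 208 required by
   [mle_risk_ge_spike]. *)
pose b0 : R := 2081 * expR 3.
have e3 : 1 <= expR (3 : R) by rewrite -expR0 ler_expR.
have b01 : 1 <= b0 by rewrite /b0; lra.
exists (b0 ^+ 2), (40 ^+ 2), (Num.min u1 1); split.
  by rewrite lt_min u10 ltr01.
move=> d p s p1 ph s0 pln hyp dd lnd; rewrite le_min => /andP[uu1 uu4].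
have p0 : 0 < p by rewrite (lt_trans _ p1).
have p2 : p < 2 by move: ph h0; clear; lra.
have pm : 0 < p - 1 by rewrite subr_gt0.
have d0 : 0 < d%:R :> R by rewrite (lt_le_trans _ dd)// exprn_gt0.
pose q := p / (p - 1).
have q0 : 0 < q by rewrite divr_gt0.
have qV : q^-1 = 1 - p^-1 by rewrite /q; field; rewrite !gt_eqF.
have q2 : 2 <= q by rewrite ler_pdivlMr//; move: p2; clear; lra.
have s1 : s <= 1.
  rewrite -(@ler_pXn2r _ 2)// ?nnegrE ?(ltW s0)// expr1n.
  by rewrite (le_trans _ uu4)// ler_peMr// sqr_ge0.
have M : (minimax_risk (@lp_ball R d p) s <= (c / (A + 1))%:E)%E.
  by apply: mm1 => //; exact: ltW.
(* From [ln d >= 1], 24 <= 2 (p - 1) ln d, and [q <= 2 / (p - 1)]. *)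
have q6 : q <= ln d%:R / 6.
  by rewrite ler_pdivrMr//; move: p2 pm pln lnd; clear; nra.
(* Counting coordinates with noise above [sqrt q * s] recovers the factor [sqrt q] of the Gaussian
   q-norm. The choice of [r] keeps [r ^ (1 / q)] equal to the constant [expR (- 3)]. *)
pose t := Num.sqrt q; have t0 : 0 < t by rewrite sqrtr_gt0.
have t2 : t ^+ 2 = q by rewrite sqr_sqrtr// ltW.
pose r := expR (- (3 * q)).
have r0 : 0 < r by exact: expR_gt0.
have rt : r <= expR (- (t + 1) ^+ 2 / 2) / 3.
  have e2 : 3 <= expR (2 : R) by have := expR_ge1Dx (2 : R); clear; lra.
  rewrite ler_pdivlMr//; apply: (@le_trans _ _ (r * expR 2)).
    by rewrite ler_pM2l.
  rewrite /r -expRD ler_expR; have := sqr_ge0 (t - 1).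
  by move: t2 q2; clear; nra.
have d1 : (0 < d)%N by rewrite -(ltr0n R).
have dm : d%:R / 2 <= d.-1%:R :> R.
  rewrite -subn1 natrB//; move: dd; clear; lra.
(* Since [3 q <= ln d / 2], [d * r] is at least the square root of [d], which explains the threshold
   [40 ^+ 2]. *)
have rd : 40 <= d%:R * r.
  apply: (@le_trans _ _ (d%:R `^ 2^-1)).
    rewrite powR12_sqrt ?(ltW d0)//.
    have -> : (40 : R) = Num.sqrt (40 ^+ 2) by rewrite sqrtr_sqr ger0_norm.
    exact: ler_wsqrtr.
  rewrite -ler_ln ?posrE ?powR_gt0 ?mulr_gt0// ln_powR lnM ?posrE// /r expRK.
  by move: q6; clear; lra.
have rd' : d%:R / 2 * r <= d.-1%:R * r by rewrite ler_pM2r.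
have dr20 : 20 <= d.-1%:R * r by move: rd rd'; clear; lra.
have big : 208 < s * t * (d.-1%:R * r / 5) `^ (1 - p^-1).
  have pV : 0 < p^-1 by rewrite invr_gt0.
  have q1 : q^-1 <= 1 by rewrite qV gerBl ltW.
  have step1 : d%:R `^ q^-1 * (expR (- 3) / 10) <= (d.-1%:R * r / 5) `^ (1 - p^-1).
    apply: (@le_trans _ _ ((d%:R * r / 10) `^ q^-1)).
      rewrite -mulrA powRM ?divr_ge0 ?(ltW d0) ?(ltW r0)// ler_pM2l ?powR_gt0//.
      rewrite powRM ?(ltW r0)//.
      have -> : r `^ q^-1 = expR (- 3).
        apply: ln_inj; rewrite ?posrE ?powR_gt0 ?expR_gt0//.
        by rewrite ln_powR !expRK; field; rewrite gt_eqF.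
      rewrite ler_pM2l ?expR_gt0//.
      by apply: ger1_powR => //; rewrite invr_gt0 invf_le1 ?ltr0n// ler1n.
    rewrite -qV ge0_ler_powR ?nnegrE ?invr_ge0 ?(ltW q0)//.
    - by rewrite divr_ge0// mulr_ge0// ltW.
    - by rewrite divr_ge0// mulr_ge0// ltW.
    - by move: rd'; clear; lra.
  have step2 : b0 <= s * t * d%:R `^ q^-1.
    rewrite qV; apply: width_lower => //; first by rewrite p1 ltW.
  have st0 : 0 < s * t by rewrite mulr_gt0.
  have e30 : 0 < expR (- 3 : R) / 10 by rewrite divr_gt0 ?expR_gt0.
  apply: (@lt_le_trans _ _ (b0 * (expR (- 3) / 10))).
    have -> : b0 * (expR (- 3) / 10) = 2081 / 10.
      by rewrite /b0 expRN; field; rewrite gt_eqF ?expR_gt0.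
    by clear; lra.
  apply: (@le_trans _ _ (s * t * (d%:R `^ q^-1 * (expR (- 3) / 10)))).
    by rewrite [leRHS]mulrA ler_pM2r.
  by rewrite ler_pM2l.
have L : (c%:E <= mle_risk (@lp_ball R d p) s)%E.
  apply: (@mle_risk_ge_spike R d p s t r) => //; last exact: ltW.
  - by rewrite p1 ltW.
  - by rewrite s0.
apply: (ratio_ge c0 A0 L (minimax_risk_ge0 d s p0) M).
by rewrite mulrA ler_pdivrMr// mulrC ler_pM2l// lerDl.
Qed.

End regimes.

(** * The two limits, from lower bounds on the ratio that hold for all large [d] *)

Theorem theorem2 (R : realType) :
  (forall (p : R) (sigma : R^nat),
     1 < p -> p < 2 ->
     (forall d, 0 < sigma d) ->
     much_greater (fun d => sigma d `^ p * d%:R) (fun=> 1) ->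
     much_less (fun d => sigma d ^+ 2 * ln d%:R) (fun=> 1) ->
     mle_competitive_ratio (@lp_ball R d p) (sigma d) @[d --> \oo] --> +oo%E)
  /\
  (forall (p sigma : R^nat),
     (forall d, 1 <= p d) ->
     much_greater (fun d => p d - 1) (fun d => 1 / (1 + ln d%:R)) ->
     (limn_esup (fun d => (p d)%:E) < 2%:E)%E ->
     (forall d, 0 < sigma d) ->
     much_greater (fun d => sigma d `^ p d * d%:R)
       (fun d => d%:R `^ (2 - p d) * (1 - 1 / p d) `^ (p d / 2)) ->
     much_less (fun d => sigma d ^+ 2 * ln d%:R) (fun=> 1) ->
     mle_competitive_ratio (@lp_ball R d (p d)) (sigma d)
       @[d --> \oo] --> +oo%E).
Proof.
have large (x : R) : \forall d \near \oo, x <= d%:R.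
  exact: nbhs_infty_ger.
have ln_large : \forall d \near \oo, 1 <= ln d%:R :> R.
  near=> d; rewrite -[leLHS]expRK ler_ln ?posrE ?expR_gt0//.
    by near: d; exact: large.
  by near: d; apply: filterS (large 1) => d; exact: lt_le_trans.
have small_noise (sigma : R^nat) u : 0 < u ->
    much_less (fun d => sigma d ^+ 2 * ln d%:R) (fun=> 1) ->
    \forall d \near \oo, sigma d ^+ 2 * ln d%:R <= u.
  move=> u0 /cvgryPge/(_ u^-1).
  apply: filterS => d; rewrite div1r => ud.
  (* Positivity is read off the inverse, which is at least [u^-1 > 0]. *)
  have v0 : 0 < sigma d ^+ 2 * ln d%:R.
    by rewrite -invr_gt0 (lt_le_trans _ ud)// invr_gt0.
  by rewrite -(lef_pV2 _ _) ?posrE.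
split.
- move=> p sigma p1 p2 s0 /cvgryPge sd sl.
  apply/cvgeyPge => A.
  have p12 : 1 < p < 2 by rewrite p1.
  have A0 : 0 <= Num.max 0 A by rewrite le_max lexx.
  have [x0 [d0 [u0 [u00 H]]]] := ratio_fixed_p p12 A0.
  near=> d; apply: (@le_trans _ _ (Num.max 0 A)%:E).
    by rewrite lee_fin le_max lexx orbT.
  apply: H => //.
  + have : x0 <= sigma d `^ p * d%:R / 1 by near: d; exact: sd.
    by rewrite divr1.
  + by near: d; exact: large.
  + by near: d.
  + by near: d; exact: small_noise.
- move=> p sigma p1 /cvgryPge pd plim s0 /cvgryPge sd sl.
  (* A limsup below 2 gives a [c < 2] that bounds [p d] for all large [d]; half of the gap [2 - c]
     is [h]. *)
  have [h h0 ph] : exists2 h, 0 < h & \forall d \near \oo, p d <= 2 - 2 * h.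
    have [_ [V Vinf <-] supV] := ereal_inf_lt plim.
    have [c supc c2] : exists2 c : R, (ereal_sup [set (p d)%:E | d in V] <= c%:E)%E & c < 2.
      move: supV; case: ereal_sup => [x| |] //.
        by rewrite lte_fin => x2; exists x.
      by move=> _; exists 0 => //; rewrite leNye.
    exists ((2 - c) / 2); first by rewrite divr_gt0// subr_gt0.
    apply: filterS Vinf => d Vd.
    rewrite (_ : 2 - 2 * ((2 - c) / 2) = c); last by field.
    by rewrite -lee_fin (le_trans _ supc)//; apply: ereal_sup_ubound; exists d.
  apply/cvgeyPge => A.
  have A0 : 0 <= Num.max 0 A by rewrite le_max lexx.
  have [b [d0 [u0 [u00 H]]]] := ratio_varying_p h0 A0.
  near=> d; apply: (@le_trans _ _ (Num.max 0 A)%:E).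
    by rewrite lee_fin le_max lexx orbT.
  have lnd : 1 <= ln d%:R :> R by near: d.
  have ln0 : 0 < 1 + ln d%:R :> R by move: lnd; clear; lra.
  have pln : 24 <= (p d - 1) * (1 + ln d%:R).
    have : 24 <= (p d - 1) / (1 / (1 + ln d%:R)) by near: d; exact: pd.
    by rewrite div1r invrK.
  (* The growth condition on [p d - 1] yields the strict inequality for large [d]. *)
  have pd1 : 1 < p d.
    by rewrite -subr_gt0 -(pmulr_lgt0 _ ln0) (lt_le_trans _ pln).
  apply: H => //.
  + by near: d.
  + have dp : 0 < d%:R :> R.
      by near: d; apply: filterS (large 1) => d; exact: lt_le_trans.
    rewrite -ler_pdivlMr; first by near: d; exact: sd.
    rewrite mulr_gt0 ?powR_gt0// subr_gt0 ltr_pdivrMr ?mul1r//.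
    exact: lt_trans pd1.
  + by near: d; exact: large.
  + by near: d; exact: small_noise.
Unshelve. all: by end_near. Qed.
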